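(* Consider the controlled dynamic system $$\ddot{\bm q}=\bm f(\bm q,\dot{\bm q})+\bm u,\qquad \bm q(t),\bm u(t)\in\mathbb{R}^n,$$ and assume the system is conservative and autonomous (in the sense defined in the context), so that $\bm f(\bm q,\dot{\bm q})=\bm g(\bm q,\dot{\bm q})+\bm h(\bm q)$, where $\bm g$ consists of the velocity-dependent terms and $\bm h$ of the strictly position-dependent terms. Define $$L(\bm q,\bm u,\dot{\bm q},\dot{\bm u})=\dot{\bm u}^T\dot{\bm q}+\bm u^T\frac{\partial \bm f}{\partial\dot{\bm q}}\dot{\bm q}-\bm u^T\bm g+\bm u^T\bm h+\frac12\bm u^T\bm u .$$ Then, for the functional $\int_{t_0}^{t_f}L\,dt$: 1. stationarity with respect to the generalized coordinates $\bm q$ gives the optimal control differential equations $$\ddot{\bm u}=-\left(\frac{\partial \bm f}{\partial\dot{\bm q}}\right)^T\dot{\bm u}-\left[\frac{d}{dt}\left(\frac{\partial \bm f}{\partial\dot{\bm q}}\right)-\frac{\partial \bm f}{\partial\bm q}\right]^T\bm u;$$ 2. stationarity with respect to the control variables $\bm u$ gives the original state differential equations $$\ddot{\bm q}=\bm f(\bm q,\dot{\bm q})+\bm u .$$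
   Context: Conservative and autonomous system: the uncontrolled equations of motion $\ddot{\bm q}=\bm f(\bm q,\dot{\bm q})$ are the Euler-Lagrange equations $\frac{d}{dt}\frac{\partial\mathcal L}{\partial\dot{\bm q}}-\frac{\partial\mathcal L}{\partial\bm q}=\bm 0$ (solved for $\ddot{\bm q}$) of a classical Lagrangian $\mathcal L=T-V$, with potential energy $V=V(\bm q)$ and kinetic energy $T=\frac12\sum_i m_i|\dot{\bm r}_i|^2$, where the position vectors $\bm r_i=\bm r_i(\bm q)$ depend only on the generalized coordinates. Thus $T=\frac12\dot{\bm q}^TM(\bm q)\dot{\bm q}$ with mass matrix $M(\bm q)\in\mathbb{R}^{n\times n}$ symmetric, positive semidefinite and invertible, depending only on $\bm q$. In the splitting $\bm f=\bm g+\bm h$, one has $\bm h(\bm q)=-M^{-1}\left(\frac{\partial V}{\partial\bm q}\right)^T$ and $\bm g=\bm f-\bm h$, i.e. componentwise $$\bm g=M^{-1}\bm w,\qquad w_k=\frac12\sum_{i,j}\frac{\partial M_{ij}}{\partial q_k}\dot q_i\dot q_j-\sum_{i,j}\frac{\partial M_{kj}}{\partial q_i}\dot q_i\dot q_j .$$ Stationarity with respect to $\bm q$ (resp. $\bm u$) means that the first variation of $\int_{t_0}^{t_f}L\,dt$ vanishes for all variations $\delta\bm q$ (resp. $\delta\bm u$) that vanish at $t_0$ and $t_f$, the other function being held fixed; equivalently, that the Euler-Lagrange equation $\frac{d}{dt}\frac{\partial L}{\partial\dot{\bm q}}-\frac{\partial L}{\partial\bm q}=\bm 0$ (resp. $\frac{d}{dt}\frac{\partial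 L}{\partial\dot{\bm u}}-\frac{\partial L}{\partial\bm u}=\bm 0$) holds on $[t_0,t_f]$. $\frac{\partial \bm f}{\partial \bm q}$ and $\frac{\partial \bm f}{\partial\dot{\bm q}}$ are the $n\times n$ Jacobian matrices with $(i,j)$ entries $\partial f_i/\partial q_j$ and $\partial f_i/\partial\dot q_j$, with $\bm q,\dot{\bm q}$ treated as independent arguments. $\frac{d}{dt}$ is the total time derivative along $\bm q(t)$. All functions are assumed smooth enough for the derivatives written to exist. The ''optimal control differential equations'' are the equations satisfied by the optimal control for minimizing $\frac12\int_{t_0}^{t_f}\bm u^T\bm u\,dt$ subject to $\ddot{\bm q}=\bm f+\bm u$ and terminal state constraints. *)

(* Defs.v *)
From HB Require Import structures.
From mathcomp Require Import all_boot all_order all_algebra.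
From mathcomp Require Import all_classical all_reals all_analysis.

Set Implicit Arguments.
Unset Strict Implicit.
Unset Printing Implicit Defensive.

Import Order.TTheory GRing.Theory Num.Theory.
Import numFieldNormedType.Exports.

Local Open Scope ring_scope.
Local Open Scope classical_set_scope.

(* F is of class C^k at the points of Q.  For Q open and U of finite dimension
   this is the usual notion: the directional derivatives are the linear
   combinations of the partial derivatives. *)
Fixpoint is_Ck (R : realType) (U W : normedModType R) (k : nat) (Q : set U)
    (F : U -> W) : Prop :=
  match k with
  | 0 => forall x, Q x -> {for x, continuous F}
  | k'.+1 => (forall x, Q x -> differentiable F x) /\
             (forall v : U, is_Ck k' Q (fun x => 'D_v F x))
  end.

(* The Euclidean inner product x^T y; the norm `|x| of the library on matrices
   is the sup norm. *)
Definition dot (R : realType) (n : nat) (x y : 'cV[R]_n) : R :=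
  (x^T *m y) ord0 ord0.

Definition partial (R : realType) (n : nat) (j : 'I_n) (F : 'cV[R]_n -> R)
    (x : 'cV[R]_n) : R :=
  'D_(delta_mx j ord0 : 'cV[R]_n) F x.

Definition grad (R : realType) (n : nat) (F : 'cV[R]_n -> R)
    (x : 'cV[R]_n) : 'cV[R]_n :=
  \col_(j < n) partial j F x.

(* Entry (i, j) is dF_i/dx_j.  The library's 'J is for row vectors and is the
   transpose of this matrix. *)
Definition jac (R : realType) (n p : nat) (F : 'cV[R]_n -> 'cV[R]_p)
    (x : 'cV[R]_n) : 'M[R]_(p, n) :=
  \matrix_(i < p, j < n) partial j (fun y => F y i ord0) x.

(* For a function of (position, velocity), the Jacobians in each argument. *)
Definition jac_pos (R : realType) (n : nat)
    (f : 'cV[R]_n -> 'cV[R]_n -> 'cV[R]_n) (x v : 'cV[R]_n) : 'M[R]_n :=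
  jac (fun y => f y v) x.

Definition jac_vel (R : realType) (n : nat)
    (f : 'cV[R]_n -> 'cV[R]_n -> 'cV[R]_n) (x v : 'cV[R]_n) : 'M[R]_n :=
  jac (f x) v.

(* d/dt (dLg/dv) - dLg/dx along the curve c, at time t. *)
Definition euler_lagrange (R : realType) (n : nat)
    (Lg : 'cV[R]_n -> 'cV[R]_n -> R) (c : R -> 'cV[R]_n) (t : R) : 'cV[R]_n :=
  derive1 (fun s => grad (Lg (c s)) (derive1 c s)) t
  - grad (fun y => Lg y (derive1 c t)) (c t).

(* 1/2 sum_i m_i |dr_i/dt|^2, where dr_i/dt = (dr_i/dq) v for a motion through x
   with velocity v. *)
Definition kinetic (R : realType) (n d N : nat) (m : 'I_N -> R)
    (r : 'I_N -> 'cV[R]_n -> 'cV[R]_d) (x v : 'cV[R]_n) : R :=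
  2^-1 * \sum_(i < N) m i * dot (jac (r i) x *m v) (jac (r i) x *m v).

Definition mass_matrix (R : realType) (n d N : nat) (m : 'I_N -> R)
    (r : 'I_N -> 'cV[R]_n -> 'cV[R]_d) (x : 'cV[R]_n) : 'M[R]_n :=
  \sum_(i < N) m i *: ((jac (r i) x)^T *m jac (r i) x).

Definition mech_lagrangian (R : realType) (n d N : nat) (m : 'I_N -> R)
    (r : 'I_N -> 'cV[R]_n -> 'cV[R]_d) (V : 'cV[R]_n -> R)
    (x v : 'cV[R]_n) : R :=
  kinetic m r x v - V x.

(* Q is the domain of the generalized coordinates; it may be all of R^n, but for
   coordinates such as polar ones the mass matrix degenerates somewhere.
   The last field says that x'' = f(x, x') is the Euler-Lagrange equation of
   T - V solved for x''; it determines f on Q x R^n. *)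
Record conservative_system (R : realType) (n d N : nat) (Q : set 'cV[R]_n)
    (m : 'I_N -> R) (r : 'I_N -> 'cV[R]_n -> 'cV[R]_d) (V : 'cV[R]_n -> R)
    (f : 'cV[R]_n -> 'cV[R]_n -> 'cV[R]_n) : Prop := ConservativeSystem {
  cs_open : open Q ;
  cs_mass_gt0 : forall i, 0 < m i ;
  cs_r_C3 : forall i, is_Ck 3 Q (r i) ;
  cs_V_C2 : is_Ck 2 Q V ;
  cs_mass_unit : forall x, Q x -> mass_matrix m r x \in unitmx ;
  cs_motion : forall c : R -> 'cV[R]_n, is_Ck 2 [set: R] c ->
    forall t : R, Q (c t) ->
      (derive1n 2 c t = f (c t) (derive1 c t) <->
       euler_lagrange (mech_lagrangian m r V) c t = 0)
}.

Definition h_part (R : realType) (n d N : nat) (m : 'I_N -> R)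
    (r : 'I_N -> 'cV[R]_n -> 'cV[R]_d) (V : 'cV[R]_n -> R)
    (x : 'cV[R]_n) : 'cV[R]_n :=
  - (invmx (mass_matrix m r x) *m grad V x).

Definition g_part (R : realType) (n d N : nat) (m : 'I_N -> R)
    (r : 'I_N -> 'cV[R]_n -> 'cV[R]_d) (V : 'cV[R]_n -> R)
    (f : 'cV[R]_n -> 'cV[R]_n -> 'cV[R]_n) (x v : 'cV[R]_n) : 'cV[R]_n :=
  f x v - h_part m r V x.

Definition control_lagrangian (R : realType) (n : nat)
    (f g : 'cV[R]_n -> 'cV[R]_n -> 'cV[R]_n) (h : 'cV[R]_n -> 'cV[R]_n)
    (q u qd ud : 'cV[R]_n) : R :=
  dot ud qd + dot u (jac_vel f q qd *m qd) - dot u (g q qd) + dot u (h q)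
  + 2^-1 * dot u u.

Definition action (R : realType) (n : nat)
    (L : 'cV[R]_n -> 'cV[R]_n -> 'cV[R]_n -> 'cV[R]_n -> R) (t0 tf : R)
    (q u : R -> 'cV[R]_n) : R :=
  (\int[lebesgue_measure]_(t in `[t0, tf])
     L (q t) (u t) (derive1 q t) (derive1 u t))%R.

(* The first variation of the functional J at the curve x exists and vanishes in
   every direction that is zero at t0 and tf. *)
Definition stationary (R : realType) (n : nat) (t0 tf : R)
    (J : (R -> 'cV[R]_n) -> R) (x : R -> 'cV[R]_n) : Prop :=
  forall eta : R -> 'cV[R]_n, is_Ck 2 [set: R] eta ->
    eta t0 = 0 -> eta tf = 0 ->
    is_derive (0 : R) (1 : R) (fun e : R => J (fun t => x t + e *: eta t))
      (0 : R).

(* Main.v *)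
Require Import Defs.
From HB Require Import structures.
From mathcomp Require Import all_boot all_order all_algebra.
From mathcomp Require Import all_classical all_reals all_analysis.
From mathcomp Require Import ring lra.

Set Implicit Arguments.
Unset Strict Implicit.
Unset Printing Implicit Defensive.

Import Order.TTheory GRing.Theory Num.Theory.
Import numFieldNormedType.Exports.

Local Open Scope ring_scope.
Local Open Scope classical_set_scope.

(** The kinetic energy is a quadratic form in the velocity, so the part g of the
    force is quadratic and homogeneous in the velocity while h depends on the
    position only ([motion_explicit], [g_partE]; the first is obtained by testing
    the equation of motion on a curve with prescribed position, velocity and
    acceleration).  Euler's theorem on homogeneous functions then gives
    (df/dv) v = 2 g ([jac_vel_euler]), and the control Lagrangian collapses to

      L = u' . q' + u . f(q, q') + (1/2) u . u        ([control_lagrangianE]).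

    From here the two claims are Euler-Lagrange equations.  Varying q, the
    momentum is dL/dq' = u' + (df/dv)^T u and the force is dL/dq = (df/dq)^T u;
    the equation d/dt (dL/dq') = dL/dq, expanded, is the equation for u''
    ([pos_stationary]).  Varying u, the momentum is dL/du' = q' and
    dL/du = f + u, which gives q'' = f + u ([ctrl_stationary]).

    Both are instances of [stationary_euler_lagrange], which treats a Lagrangian
    depending on time, position and velocity that is C^1 together with its
    momenta on an open set of phase space.  It rests on differentiation under
    the integral sign ([is_derive_Rintegral]), on integration by parts against
    variations that vanish at the end points ([first_variation]) and on the
    fundamental lemma of the calculus of variations ([fundamental_lemma]). *)

(** * Functions of class C^k *)

Lemma near_eq_differentiable (R : realType) (U W : normedModType R)
    (F G : U -> W) (x : U) :
  {near x, F =1 G} -> differentiable F x -> differentiable G x.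
Proof.
move=> FG dF; have FGx : F x = G x := nbhs_singleton FG.
have [cF eF] := (diff_locallyP _ _).1 dF.
have eG : G \o shift x = cst (G x) + 'd F x +o_ 0 id.
  apply/eqaddoP => _/posnumP[e].
  have /eqaddoP /(_ e%:num) /(_ [gt0 of e%:num]) := eF.
  have : \forall h \near (0 : U), F (h + x) = G (h + x).
    suff : (fun h : U => h + x) @ (0 : U) --> x by move=> h0x; exact: (h0x _ FG).
    rewrite -[X in _ --> X]add0r.
    by apply: cvgD; [exact: cvg_id|exact: cvg_cst].
  by apply: filterS2 => h /= e1; rewrite /= !fctE /= -e1 FGx.
have dGE := diff_unique cF eG.
by apply/diff_locallyP; split; rewrite dGE.
Qed.

Lemma derive_comp (R : realType) (U V W : normedModType R) (f : U -> V)
    (g : V -> W) (x v : U) : differentiable f x -> differentiable g (f x) ->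
  'D_v (g \o f) x = 'D_('D_v f x) g (f x).
Proof.
move=> df dg; have dgf : differentiable (g \o f) x by exact: differentiable_comp.
by rewrite (deriveE _ dgf) (deriveE _ df) (deriveE _ dg) diff_comp.
Qed.

Lemma derive_dirZ (R : realType) (U W : normedModType R) (F : U -> W)
    (x v : U) (r : R) : differentiable F x -> 'D_(r *: v) F x = r *: 'D_v F x.
Proof. by move=> dF; rewrite !(deriveE _ dF) linearZ. Qed.

Section Ck.
Variable R : realType.

Section CkUW.
Variables U W : normedModType R.
Implicit Types (Q : set U) (F G : U -> W).

(** Q is open, so functions equal on Q are equal near each of its points and
    have the same derivatives there. *)
Lemma Ck_congr k Q F G : open Q -> (forall x, Q x -> F x = G x) ->
  is_Ck k Q F -> is_Ck k Q G.
Proof.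
move=> oQ; elim: k F G => [|k IH] F G FG /=.
  move=> cF x Qx; have FGn : \near x, F x = G x.
    by apply: filterS (open_nbhs_nbhs (conj oQ Qx)) => y /FG.
  apply: cvg_trans (near_eq_cvg FGn) _.
  by rewrite -(FG x Qx); exact: cF.
move=> [dF cF].
have FGn x : Q x -> \near x, F x = G x.
  by move=> Qx; apply: filterS (open_nbhs_nbhs (conj oQ Qx)) => y /FG.
split=> [x Qx|v]; first exact: near_eq_differentiable (FGn x Qx) (dF x Qx).
by apply: IH (cF v) => x Qx; exact: near_eq_derive (FGn x Qx).
Qed.

Lemma Ck_pred k Q F : is_Ck k.+1 Q F -> is_Ck k Q F.
Proof.
elim: k F => [F [dF _] x Qx|k IH F [dF cF]].
  exact/differentiable_continuous/dF.
by split=> // v; exact/IH/cF.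
Qed.

Lemma Ck_subset k Q Q' F : Q' `<=` Q -> is_Ck k Q F -> is_Ck k Q' F.
Proof.
move=> QQ'; elim: k F => [F cF x /QQ'|k IH F [dF cF]]; first exact: cF.
by split=> [x /QQ'/dF//|v]; exact/IH/cF.
Qed.

Lemma Ck_cst k Q (a : W) : is_Ck k Q (cst a).
Proof.
elim: k a => [a x _|k IH a]; first exact: cvg_cst.
split=> // v; rewrite (_ : (fun x => _) = cst 0); first exact: IH.
by apply/funext => x; rewrite derive_cst.
Qed.

Lemma Ck_add k Q F G : open Q ->
  is_Ck k Q F -> is_Ck k Q G -> is_Ck k Q (fun x => F x + G x).
Proof.
move=> oQ; elim: k F G => [|k IH] F G /=.
  by move=> cF cG x Qx; apply: continuousD; [exact: cF|exact: cG].
move=> [dF cF] [dG cG]; split=> [x Qx|v].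
  by apply: differentiableD; [exact: dF|exact: dG].
apply: Ck_congr oQ _ (IH _ _ (cF v) (cG v)) => x Qx.
by rewrite (deriveD (diff_derivable (dF x Qx)) (diff_derivable (dG x Qx))).
Qed.

Lemma Ck_scale k Q (r : R) F : open Q ->
  is_Ck k Q F -> is_Ck k Q (fun x => r *: F x).
Proof.
move=> oQ; elim: k F => [|k IH] F /=.
  by move=> cF x Qx; apply: cvgZl_tmp; exact: cF.
move=> [dF cF]; split=> [x Qx|v]; first exact/differentiableZ/dF.
apply: Ck_congr oQ _ (IH _ (cF v)) => x Qx.
by rewrite (deriveZ r (diff_derivable (dF x Qx))).
Qed.

Lemma Ck_sum (I : Type) (s : seq I) (P : pred I) k Q (F : I -> U -> W) :
  open Q -> (forall i, is_Ck k Q (F i)) ->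
  is_Ck k Q (fun x => \sum_(i <- s | P i) F i x).
Proof.
move=> oQ CF; elim: s => [|i s IH].
  by under eq_fun do rewrite big_nil; exact: Ck_cst.
under eq_fun do rewrite big_cons.
case: (P i) => //; exact: Ck_add.
Qed.

Lemma diff_comp_lin (W' : normedModType R) (L : U -> W) (F : W -> W') z w :
  linear L -> continuous L -> differentiable F (L z) ->
  differentiable (F \o L) z /\ 'D_w (F \o L) z = 'D_(L w) F (L z).
Proof.
move=> lL cL dF.
pose LM := GRing.isLinear.Build _ _ _ _ _ lL.
pose LL : {linear U -> W} := HB.pack L LM.
have dL : differentiable L z by exact: (@linear_differentiable _ _ _ LL).
split; first exact: differentiable_comp.
rewrite (derive_comp _ dL dF) (deriveE _ dL).
by have /= -> := (@diff_lin _ _ _ LL z cL).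
Qed.

End CkUW.

Lemma Ck_comp_lin (U W W' : normedModType R) k (L : U -> W) (F : W -> W')
    (Q : set W) : linear L -> continuous L -> open Q ->
  is_Ck k Q F -> is_Ck k (L @^-1` Q) (F \o L).
Proof.
move=> lL cL oQ.
have oLQ : open (L @^-1` Q) by apply: open_comp => // x _; exact: cL.
elim: k F => [|k IH] F /=.
  move=> cF x Qx; apply: continuous_comp; [exact: cL|exact: cF].
move=> [dF cF]; split=> [x Qx|v].
  by have [] := diff_comp_lin 0 lL cL (dF _ Qx).
apply: Ck_congr oLQ _ (IH _ (cF (L v))) => x Qx.
by have [_ ->] := diff_comp_lin v lL cL (dF _ Qx).
Qed.

Lemma Ck_lin (U W : normedModType R) k (L : U -> W) (Q : set U) :
  linear L -> continuous L -> is_Ck k Q L.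
Proof.
move=> lL cL; case: k => [x _|k]; first exact: cL.
have dL x v : differentiable L x /\ 'D_v L x = L v.
  have [//|dL ->] := @diff_comp_lin U W W L idfun x v lL cL.
  by split=> //; rewrite derive_id.
split=> [x _|v]; first by have [] := dL x 0.
rewrite (_ : (fun x => _) = cst (L v)); first exact: Ck_cst.
by apply/funext => x; have [] := dL x v.
Qed.

Lemma Ck_coord (U : normedModType R) k p q (F : U -> 'M[R]_(p, q))
    (Q : set U) i j : open Q ->
  is_Ck k Q F -> is_Ck k Q (fun x => F x i j).
Proof.
move=> oQ; elim: k F => [|k IH] F /=.
  move=> cF x Qx; apply: (@continuous_comp _ _ _ F (fun M => M i j)).
    exact: cF.
  exact: coord_continuous.
move=> [dF cF]; split=> [x Qx|v].
  apply: (@differentiable_comp _ _ _ _ F (fun M => M i j)); first exact: dF.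
  exact: differentiable_coord.
apply: Ck_congr oQ _ (IH _ (cF v)) => x Qx.
by rewrite derive_mx ?mxE//; exact/diff_derivable/dF.
Qed.

Lemma Ck_scalel (U W : normedModType R) k (F : U -> R) (w : W) (Q : set U) :
  open Q -> is_Ck k Q F -> is_Ck k Q (fun x => F x *: w).
Proof.
move=> oQ; elim: k F => [|k IH] F /=.
  by move=> cF x Qx; apply: cvgZr_tmp; exact: cF.
move=> [dF cF]; split=> [x Qx|v]; first exact/differentiableZl/dF.
apply: Ck_congr oQ _ (IH _ (cF v)) => x Qx.
have dZ : differentiable (fun x => F x *: w) x by exact/differentiableZl/dF.
by rewrite (deriveE _ dZ) (deriveE _ (dF x Qx)) diffZl//; exact: dF.
Qed.

Section CkR.
Variable U : normedModType R.
Implicit Types (Q : set U) (F G : U -> R).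

Lemma Ck_mul k Q F G : open Q ->
  is_Ck k Q F -> is_Ck k Q G -> is_Ck k Q (fun x => F x * G x).
Proof.
move=> oQ; elim: k F G => [|k IH] F G.
  by move=> cF cG x Qx; apply: continuousM; [exact: cF|exact: cG].
move=> CF CG; have [dF cF] := CF; have [dG cG] := CG; split=> [x Qx|v].
  by apply: differentiableM; [exact: dF|exact: dG].
apply: Ck_congr oQ _ (Ck_add oQ (IH _ _ (Ck_pred CF) (cG v))
                                (IH _ _ (Ck_pred CG) (cF v))) => x Qx.
by rewrite (deriveM (diff_derivable (dF x Qx)) (diff_derivable (dG x Qx))).
Qed.

Lemma Ck_prod (I : Type) (s : seq I) (P : pred I) k Q (F : I -> U -> R) :
  open Q -> (forall i, is_Ck k Q (F i)) ->
  is_Ck k Q (fun x => \prod_(i <- s | P i) F i x).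
Proof.
move=> oQ CF; elim: s => [|i s IH].
  by under eq_fun do rewrite big_nil; exact: Ck_cst.
under eq_fun do rewrite big_cons.
case: (P i) => //; exact: Ck_mul.
Qed.

Lemma Ck_opp k Q F : open Q -> is_Ck k Q F -> is_Ck k Q (fun x => - F x).
Proof.
move=> oQ CF; under eq_fun do rewrite -mulN1r.
by apply: Ck_mul => //; exact: Ck_cst.
Qed.

(** The derivative - F^-1 F^-1 (D_v F) involves F^-1 itself, one order lower in
    the induction. *)
Lemma Ck_inv k Q F : open Q -> (forall x, Q x -> F x != 0) ->
  is_Ck k Q F -> is_Ck k Q (fun x => (F x)^-1).
Proof.
move=> oQ F0; elim: k => [|k IH] CF.
  by move=> x Qx; apply: continuousV; [exact: F0|exact: CF].
have [dF cF] := CF; split=> [x Qx|v].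
  by apply: differentiableV; [exact: dF|exact: F0].
have CV := IH (Ck_pred CF).
have := Ck_opp oQ (Ck_mul oQ (Ck_mul oQ CV CV) (cF v)).
apply: Ck_congr => // x Qx.
rewrite (@deriveV _ _ F x v (F0 x Qx) (diff_derivable (dF x Qx))).
by rewrite expr2 invfM scaleNr.
Qed.

Lemma Ck_det k Q n (A : U -> 'M[R]_n) : open Q ->
  (forall i j, is_Ck k Q (fun x => A x i j)) -> is_Ck k Q (fun x => \det (A x)).
Proof.
move=> oQ CA; apply: Ck_sum => // s; apply: Ck_mul => //; first exact: Ck_cst.
by apply: Ck_prod => // i; exact: CA.
Qed.

(** Cramer's rule: the inverse is the adjugate, polynomial in the entries,
    divided by the determinant. *)
Lemma Ck_invmx k Q n (A : U -> 'M[R]_n) i j : open Q ->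
  (forall x, Q x -> A x \in unitmx) ->
  (forall i j, is_Ck k Q (fun x => A x i j)) ->
  is_Ck k Q (fun x => invmx (A x) i j).
Proof.
move=> oQ uA CA.
have CD := Ck_det oQ CA.
have D0 x : Q x -> \det (A x) != 0 by move=> /uA; rewrite unitmxE unitfE.
have Cc : is_Ck k Q (fun x => cofactor (A x) j i).
  apply: Ck_mul => //; first exact: Ck_cst.
  by apply: Ck_det => // a b; under eq_fun do rewrite !mxE; exact: CA.
apply: Ck_congr oQ _ (Ck_mul oQ (Ck_inv oQ D0 CD) Cc) => x Qx.
by rewrite /invmx uA // !mxE.
Qed.

End CkR.
End Ck.

(** * Integrals depending on a parameter and the fundamental lemma *)

Section Integrals.
Variable R : realType.
Implicit Types (a b : R) (A G phi : R -> R).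
Local Notation mu := (@lebesgue_measure R).

Lemma continuous_on_itv_integrable a b A :
  (forall t, a <= t <= b -> {for t, continuous A}) ->
  mu.-integrable `[a, b] (EFin \o A).
Proof.
move=> cA; apply: continuous_compact_integrable; first exact: segment_compact.
by apply: continuous_in_subspaceT => t; rewrite inE /= in_itv /=; exact: cA.
Qed.

Lemma Rintegral_continuousD a b (A B : R -> R) :
  (forall t, a <= t <= b -> {for t, continuous A}) ->
  (forall t, a <= t <= b -> {for t, continuous B}) ->
  (\int[mu]_(t in `[a, b]) (A t + B t))%R =
  (\int[mu]_(t in `[a, b]) A t)%R + (\int[mu]_(t in `[a, b]) B t)%R.
Proof.
move=> cA cB; apply: RintegralD; first exact: measurable_itv.
  exact: continuous_on_itv_integrable.
exact: continuous_on_itv_integrable.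
Qed.

Lemma Rintegral_derive a b A (A' : R -> R) : a < b ->
  (forall t, a <= t <= b -> is_derive t 1 A (A' t)) ->
  (forall t, a <= t <= b -> {for t, continuous A'}) ->
  (\int[mu]_(t in `[a, b]) A' t)%R = A b - A a.
Proof.
move=> ab dA cA'.
have cA t : a <= t <= b -> {for t, continuous A}.
  move=> tab; apply/differentiable_continuous/derivable1_diffP.
  by have [] := dA t tab.
rewrite /Rintegral (@continuous_FTC2 _ A' A)//=.
- apply: continuous_in_subspaceT => t; rewrite inE /= in_itv /=; exact: cA'.
- split.
  + move=> t; rewrite in_itv /= => /andP[at_ tb].
    by have [] := dA t; rewrite ?(ltW at_) ?(ltW tb).
  + by apply: cvg_at_right_filter; apply: cA; rewrite lexx ltW.
  + by apply: cvg_at_left_filter; apply: cA; rewrite lexx ltW.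
- move=> t; rewrite in_itv /= => /andP[at_ tb]; rewrite derive1E.
  by apply: derive_val; apply: dA; rewrite ?(ltW at_) ?(ltW tb).
Qed.

(** Away from c and d the positive function G has a positive minimum, which
    bounds the integral below. *)
Lemma Rintegral_gt0 a b c d G : a <= c -> c < d -> d <= b ->
  (forall t, a <= t <= b -> {for t, continuous G}) ->
  (forall t, a <= t <= b -> 0 <= G t) ->
  (forall t, c < t < d -> 0 < G t) ->
  0 < (\int[mu]_(t in `[a, b]) G t)%R.
Proof.
move=> ac cd db cG G0 Gp.
have iG := continuous_on_itv_integrable cG.
(* The middle half of [c, d]. *)
pose a' := c + (d - c) / 4%:R; pose b' := c + 3%:R * (d - c) / 4%:R.
have ca' : c < a' by rewrite /a'; lra.
have a'b' : a' < b' by rewrite /a' /b'; lra.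
have b'd : b' < d by rewrite /b'; lra.
have cGw : {within `[a', b'], continuous G}.
  apply: continuous_in_subspaceT => t; rewrite inE /= in_itv /= => /andP[h1 h2].
  by apply: cG; lra.
have [m] := EVT_min (ltW a'b') cGw.
rewrite in_itv /= => /andP[m1 m2] mG.
have Gm : 0 < G m by apply: Gp; lra.
have sub : `[a', b'] `<=` `[a, b].
  by move=> t; rewrite /= !in_itv /= => /andP[h1 h2]; lra.
have iGs : mu.-integrable `[a', b'] (EFin \o G).
  by apply: integrableS iG.
apply: (@lt_le_trans _ _ (\int[mu]_(t in `[a', b']) (fun=> G m) t)%R).
  rewrite Rintegral_cst//= lebesgue_measure_itv /= lte_fin a'b' -EFinD /=.
  by rewrite mulr_gt0// subr_gt0.
apply: (@le_trans _ _ (\int[mu]_(t in `[a', b']) G t)%R).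
  apply: le_Rintegral => //.
    by apply: continuous_on_itv_integrable => t _; exact: cvg_cst.
rewrite /Rintegral fine_le//; [exact: integrable_fin_num..|].
apply: ge0_subset_integral => //.
  by have /integrableP[] := iG.
Qed.

End Integrals.

Section Leibniz.
Variable R : realType.
Local Notation mu := (@lebesgue_measure R).

(** By compactness of [a, b], joint continuity of F' at the points (0, t) bounds F'
    by one constant for all e near 0; this constant dominates the difference
    quotients. *)
Lemma is_derive_Rintegral (a b : R) (F F' : R -> R -> R) :
  (\forall e \near (0 : R), forall t, a <= t <= b ->
     is_derive e (1 : R) (F ^~ t) (F' e t)) ->
  (\forall e \near (0 : R), forall t, a <= t <= b -> {for t, continuous (F e)}) ->
  (forall t, a <= t <= b ->
     {for (0 : R, t), continuous (fun p : R * R => F' p.1 p.2)}) ->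
  is_derive (0 : R) (1 : R) (fun e => (\int[mu]_(t in `[a, b]) F e t)%R)
    ((\int[mu]_(t in `[a, b]) F' 0 t)%R).
Proof.
move=> dF cF cF'.
(* The pair (M, e) runs through the product of the filters at +oo and at 0, so
   that one application of compactness yields the bound and the neighbourhood. *)
have [M bM] : exists M : R, \forall e \near (0 : R), forall t, a <= t <= b ->
    `|F' e t| <= M.
  have /compact_near_coveringP nc := @segment_compact R a b.
  have := nc _ (filter_prod (pinfty_nbhs R) (nbhs (0 : R)))
    (fun Me t => `|F' Me.2 t| <= Me.1) _.
  case=> [t|[X Y] /= [[M0 [_ M0X]] Y0] XY].
    rewrite /= in_itv /= => /cF' /cvgr_dist_lt /(_ _ ltr01) [[V W] /= [V0 Wt] VW].
    exists (W, (fun Me : R * R => `|F' 0 t| + 1 < Me.1 /\ V Me.2)).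
      split=> //=.
      exists ([set M | `|F' 0 t| + 1 < M], V) => /=; last by move=> [] ? ? [].
      by split=> //; exists (`|F' 0 t| + 1); split=> //; exact: num_real.
    move=> [s [M e]] /= [Ws [/ltW F'M Ve]]; apply: le_trans F'M.
    have /ltW := VW (e, s) (conj Ve Ws).
    rewrite /= distrC => h; rewrite -[X in `|X|](subrK (F' 0 t)) addrC.
    by rewrite (le_trans (ler_normD _ _))// lerD.
  exists (M0 + 1); apply: filterS Y0 => e Ye t tab.
  by apply: (XY (M0 + 1, e)); [split=> //; apply: M0X; rewrite ltrDl|rewrite /= in_itv].
have : \forall e \near (0 : R), [/\ (forall t, a <= t <= b ->
     is_derive e (1 : R) (F ^~ t) (F' e t)),
   (forall t, a <= t <= b -> {for t, continuous (F e)}) &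
   (forall t, a <= t <= b -> `|F' e t| <= M)].
  by near=> e; split; near: e.
move=> /nbhs_ballP[r /= r0 rP].
have I0 : (`]-r, r[ : set R) 0 by rewrite /= in_itv /= oppr_lt0 r0.
have Ir e : (`]-r, r[ : set R) e -> ball (0 : R) r e.
  by rewrite /ball /= in_itv /= sub0r normrN ltr_norml.
have mab : measurable (`[a, b] : set R) by exact: measurable_itv.
have iF e : (`]-r, r[ : set R) e -> mu.-integrable `[a, b] (EFin \o F e).
  by move=> /Ir/rP[_ h _]; exact: continuous_on_itv_integrable.
have dF1 e t : (`]-r, r[ : set R) e -> (`[a, b] : set R) t ->
    derivable (F ^~ t) e 1.
  by move=> /Ir/rP[h _ _]; rewrite /= in_itv /= => /h[].
have F'E e t : (`]-r, r[ : set R) e -> (`[a, b] : set R) t ->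
    partial1of2 F e t = F' e t.
  move=> /Ir/rP[h _ _]; rewrite /= in_itv /= => tab.
  by rewrite partial1of2E; apply: derive_val; exact: h.
have M0 (t : measurableTypeR R) : 0 <= (cst `|M| : _ -> R) t by [].
have iM : mu.-integrable `[a, b] (EFin \o (cst `|M|)).
  by apply: continuous_on_itv_integrable => t _; exact: cvg_cst.
have bF e t : (`]-r, r[ : set R) e -> (`[a, b] : set R) t ->
    `|partial1of2 F e t| <= (cst `|M|) t.
  move=> Ie It; rewrite F'E//= (le_trans _ (ler_norm _))//.
  by have [_ _] := rP e (Ir e Ie); apply; move: It; rewrite /= in_itv.
apply: DeriveDef.
  exact: (@derivable_under_integral R _ (measurableTypeR R) mu F _ mab 0 (- r) r I0 iF dF1 (cst `|M|) M0 iM bF).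
rewrite -derive1E (@differentiation_under_integral R _ (measurableTypeR R) mu F _ mab 0 (- r) r
  I0 iF dF1 (cst `|M|) M0 iM bF).
by apply: eq_Rintegral => t /set_mem It; exact: F'E.
Unshelve. all: by end_near. Qed.

End Leibniz.

Section Bump.
Variable R : realType.

Lemma pos_part_pow_continuous k : continuous (fun s : R => Num.max 0 s ^+ k).
Proof.
move=> s; apply: (@continuous_comp _ _ _ (fun s : R => Num.max 0 s)
  (fun s : R => s ^+ k)); last exact: exprn_continuous.
by apply: (@continuous_max _ _ (cst 0) id); [exact: cvg_cst|exact: cvg_id].
Qed.

(** At 0 the difference quotient of max(0, .)^(k+2) is max(0, .)^(k+1), which
    tends to 0. *)
Lemma is_derive_pos_part_pow k (s : R) :
  is_derive s (1 : R) (fun s : R => Num.max 0 s ^+ k.+2)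
    (k.+2%:R * Num.max 0 s ^+ k.+1).
Proof.
case: (ltgtP s 0) => [s0|s0|->].
- rewrite expr0n/= mulr0; apply: (@near_eq_is_derive _ _ _ (cst 0)).
    near=> x; rewrite max_l ?expr0n//; apply/ltW; near: x; exact: lt_nbhsl.
- apply: (@near_eq_is_derive _ R R (fun x : R => x ^+ k.+2)).
    near=> x; rewrite max_r//; apply/ltW; near: x; exact: lt_nbhsr.
  apply: DeriveDef; first exact: exprn_derivable.
  by rewrite exp_derive scaler1.
- rewrite expr0n /= mulr0.
  have quot0 : h^-1 *: (((fun s : R => Num.max 0 s ^+ k.+2) \o shift 0) (h *: 1)
      - (fun s : R => Num.max 0 s ^+ k.+2) 0) @[h --> (0 : R)^'] --> (0 : R).
    have c0 : {for 0, continuous (fun h : R => Num.max 0 h ^+ k.+1)} by exact: pos_part_pow_continuous.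
    have {}c0 : Num.max 0 h ^+ k.+1 @[h --> (0 : R)^'] --> (0 : R).
      move/continuous_withinNx : c0; rewrite maxxx expr0n /=; exact.
    apply: cvg_trans c0; apply: near_eq_cvg; near=> h.
    have h0 : h != 0 by near: h; exact: nbhs_dnbhs_neq.
    rewrite /= addr0 [h *: 1]mulr1 maxxx [0 ^+ _]expr0n /= subr0.
    case: (ltP 0 h) => hs; last by rewrite !expr0n /= scaler0.
    by rewrite [in RHS]exprS scalerA mulVf// scale1r.
  apply: DeriveDef; last exact: cvg_lim quot0.
  by apply/cvg_ex; exists 0.
Unshelve. all: by end_near. Qed.

(** Truncated powers replace smooth bump functions: variations need only be C^2. *)
Lemma Ck_pos_part_pow k (p : R -> R) : is_Ck k [set: R] p ->
  is_Ck k [set: R] (fun t => Num.max 0 (p t) ^+ k.+1).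
Proof.
elim: k => [|k IH] Cp.
  move=> t _; apply: (@continuous_comp _ _ _ p (fun s => Num.max 0 s ^+ 1)).
    exact: Cp.
  exact: pos_part_pow_continuous.
have [dp cp] := Cp.
have dpk t : differentiable (fun s : R => Num.max 0 s ^+ k.+2) (p t).
  by apply/derivable1_diffP; have [] := is_derive_pos_part_pow k (p t).
split=> [t _|v].
  exact: (differentiable_comp (dp t I) (dpk t)).
have := Ck_mul openT (Ck_mul openT (Ck_cst k setT (k.+2%:R : R))
  (IH (Ck_pred Cp))) (cp v).
apply: Ck_congr; first exact: openT.
move=> t _; rewrite (derive_comp _ (dp t I) (dpk t)).
have := derive_dirZ (1 : R) ('D_v p t) (dpk t).
rewrite [_ *: 1]mulr1 => ->.
by have [_ ->] := is_derive_pos_part_pow k (p t); rewrite /= [RHS]mulrC.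
Qed.

(** If G were positive somewhere, it would be so on an interval ]c, d[ and
    integrate to a positive number against the C^2 bump
    max(0, (s - c) (d - s))^3, whose support is [c, d].  The interval is cut to
    fit in [a, b], which handles the end points without a limit argument. *)
Lemma fundamental_lemma (a b : R) (G : R -> R) : a < b ->
  (forall t, a <= t <= b -> {for t, continuous G}) ->
  (forall phi : R -> R, is_Ck 2 [set: R] phi -> phi a = 0 -> phi b = 0 ->
     (\int[@lebesgue_measure R]_(t in `[a, b]) (G t * phi t))%R = 0) ->
  forall t, a <= t <= b -> G t = 0.
Proof.
move=> ab.
suff main (H : R -> R) : (forall t, a <= t <= b -> {for t, continuous H}) ->
  (forall phi : R -> R, is_Ck 2 [set: R] phi -> phi a = 0 -> phi b = 0 ->
     (\int[@lebesgue_measure R]_(t in `[a, b]) (H t * phi t))%R = 0) ->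
  forall t, a <= t <= b -> H t <= 0.
  move=> cG G0 t tab; apply/eqP; rewrite eq_le main//= -oppr_le0.
  apply: (main (fun t => - G t)) => // [s sab|phi Cphi phia phib].
    by apply: continuousN; exact: cG.
  have CN : is_Ck 2 [set: R] (fun t => - phi t).
    by apply: Ck_opp => //; exact: openT.
  rewrite -[RHS](G0 _ CN); [|by rewrite phia oppr0|by rewrite phib oppr0].
  by apply: eq_Rintegral => s _; rewrite mulrN mulNr.
move=> cH H0 t tab; rewrite leNgt; apply/negP => Ht.
have /nbhs_ballP[r /= r0 rH] : \forall s \near t, 0 < H s.
  exact: (cH t tab _ (lt_nbhsr Ht)).
pose c := Num.max a (t - r); pose d := Num.min b (t + r).
have cd : c < d by rewrite /c /d lt_min !gt_max; lra.
have ac : a <= c by rewrite /c le_max lexx.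
have db : d <= b by rewrite /d ge_min lexx.
have trc : t - r <= c by rewrite /c le_max lexx orbT.
have dtr : d <= t + r by rewrite /d ge_min lexx orbT.
have Hcd s : c < s < d -> 0 < H s.
  by move=> scd; apply: rH; rewrite /ball /= ltr_norml; lra.
pose p s := (s - c) * (d - s).
pose phi s := Num.max 0 (p s) ^+ 3.
have Cp : is_Ck 2 [set: R] p.
  have Cid : is_Ck 2 [set: R] (fun s : R => s).
    by apply: (@Ck_lin R R R 2 id setT) => // x; exact: cvg_id.
  have Cc (k : R) : is_Ck 2 [set: R] (fun=> k) by exact: Ck_cst.
  apply: (@Ck_mul R R 2 setT (fun s => s - c) (fun s => d - s) openT).
    exact: (@Ck_add R R R 2 setT _ _ openT Cid (Cc (- c))).
  exact: (@Ck_add R R R 2 setT _ _ openT (Cc d) (Ck_opp openT Cid)).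
have Cphi : is_Ck 2 [set: R] phi by exact: Ck_pos_part_pow.
have phi0 s : s <= c \/ d <= s -> phi s = 0.
  move=> scd; rewrite /phi max_l ?expr0n//.
  by rewrite /p; case: scd => ?; [apply: mulr_le0_ge0|apply: mulr_ge0_le0]; lra.
have phi_gt0 s : c < s < d -> 0 < phi s.
  move=> /andP[cs sd]; rewrite /phi exprn_gt0// lt_max; apply/orP; right.
  by rewrite /p mulr_gt0// subr_gt0.
have := H0 phi Cphi (phi0 _ (or_introl ac)) (phi0 _ (or_intror db)).
apply/eqP; rewrite gt_eqF//; apply: (@Rintegral_gt0 _ a b c d) => //.
- move=> s sab; apply: continuousM; first exact: cH.
  by have [dphi _] := Cphi; exact/differentiable_continuous/dphi.
- move=> s sab; case: (ltP c s) => cs; last by rewrite phi0 ?mulr0//; left.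
  case: (ltP s d) => sd; last by rewrite phi0 ?mulr0//; right.
  by rewrite mulr_ge0// ltW//; [apply: Hcd|apply: phi_gt0]; rewrite cs sd.
- by move=> s scd; rewrite mulr_gt0//; [exact: Hcd|exact: phi_gt0].
Qed.

End Bump.

(** * Phase space and jets of curves *)

Lemma pair_continuous (T V W : topologicalType) (f : T -> V) (g : T -> W)
    (s : T) : {for s, continuous f} -> {for s, continuous g} ->
  {for s, continuous (fun x => (f x, g x))}.
Proof. by move=> cf cg; exact: (cvg_pair cf cg). Qed.

Section Phase.
Variables (R : realType) (n : nat).
Local Notation E := 'cV[R]_n.
Local Notation U := (R * (E * E))%type.
Local Notation mu := (@lebesgue_measure R).

Definition ebasis (k : 'I_n) : E := delta_mx k ord0.
Definition dirt : U := (1, (0, 0)).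
Definition dirx (k : 'I_n) : U := (0, (ebasis k, 0)).
Definition dirv (k : 'I_n) : U := (0, (0, ebasis k)).

(** The phase space R * (E * E) has coordinates (time, position, velocity); a
    Lagrangian evaluated along a curve is a function composed with this lift. *)
Definition jet (x : R -> E) (t : R) : U := (t, (x t, x^`()%classic t)).

Lemma vec_ebasis (a : E) : a = \sum_k a k ord0 *: ebasis k.
Proof.
rewrite {1}(matrix_sum_delta a); apply: eq_bigr => i _.
by rewrite big_ord1.
Qed.

(** A derivative in an arbitrary direction is a combination of finitely many
    partial derivatives. *)
Lemma phase_dirE (F : U -> R) (z w : U) : differentiable F z ->
  'D_w F z = w.1 * 'D_dirt F z
    + \sum_k (w.2.1 k ord0 * 'D_(dirx k) F z + w.2.2 k ord0 * 'D_(dirv k) F z).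
Proof.
move=> dF; rewrite !(deriveE _ dF).
under eq_bigr do rewrite !(deriveE _ dF).
have wE : w = w.1 *: dirt
    + \sum_k (w.2.1 k ord0 *: dirx k + w.2.2 k ord0 *: dirv k).
  case: w => tau [a b] /=; rewrite big_split /=.
  have sx (c : E) : \sum_k c k ord0 *: dirx k = (0, (c, 0)).
    rewrite {2}(vec_ebasis c); elim/big_ind2 : _ => // [y1 y2 z1 z2 -> ->|k _].
      by congr (_, (_, _)); rewrite /= addr0.
    by congr (_, (_, _)); rewrite /= scaler0.
  have sv (c : E) : \sum_k c k ord0 *: dirv k = (0, (0, c)).
    rewrite {2}(vec_ebasis c); elim/big_ind2 : _ => // [y1 y2 z1 z2 -> ->|k _].
      by congr (_, (_, _)); rewrite /= addr0.
    by congr (_, (_, _)); rewrite /= scaler0.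
  rewrite sx sv; congr (_, (_, _)); rewrite /=.
  - by rewrite [_ *: 1]mulr1 !addr0.
  - by rewrite scaler0 add0r addr0.
  - by rewrite scaler0 !add0r.
rewrite [X in 'd F z X]wE linearD linear_sum linearZ; congr (_ + _).
by apply: eq_bigr => k _; rewrite linearD !linearZ.
Qed.

(** Class C^1 gives continuity of D_w F for each fixed w; the expansion in partial
    derivatives makes it jointly continuous when the direction varies as well. *)
Lemma derive_dir_continuous (T : topologicalType) (z w : T -> U) (P : set U)
    (F : U -> R) (s : T) : open P -> is_Ck 1 P F -> P (z s) ->
  {for s, continuous z} -> {for s, continuous w} ->
  {for s, continuous (fun s => 'D_(w s) F (z s))}.
Proof.
move=> oP [dF cF] Pz cz cw.
have Pn : \forall s' \near s, P (z s').
  by apply: cz; exact: open_nbhs_nbhs.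
pose rhs s := (w s).1 * 'D_dirt F (z s)
  + \sum_k ((w s).2.1 k ord0 * 'D_(dirx k) F (z s)
            + (w s).2.2 k ord0 * 'D_(dirv k) F (z s)).
have Fn : \forall s' \near s, rhs s' = 'D_(w s') F (z s').
  by apply: filterS Pn => s' /dF dFs; rewrite [RHS]phase_dirE.
apply: cvg_trans (near_eq_cvg Fn) _; rewrite -(nbhs_singleton Fn).
have cD v : 'D_v F (z s') @[s' --> s] --> 'D_v F (z s).
  exact: (@continuous_comp _ _ _ z (fun y => 'D_v F y) s cz (cF v _ Pz)).
have c1 : (w s').1 @[s' --> s] --> (w s).1.
  by apply: (cvg_comp _ _ cw); exact: cvg_fst.
have c2 : (w s').2 @[s' --> s] --> (w s).2.
  by apply: (cvg_comp _ _ cw); exact: cvg_snd.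
have c21 : (w s').2.1 @[s' --> s] --> (w s).2.1.
  by apply: (cvg_comp _ _ c2); exact: cvg_fst.
have c22 : (w s').2.2 @[s' --> s] --> (w s).2.2.
  by apply: (cvg_comp _ _ c2); exact: cvg_snd.
apply: cvgD; first exact: cvgM.
apply: (cvg_big (@add_continuous R)) => k _.
have cc (c : T -> E) (l : E) : c s' @[s' --> s] --> l ->
    c s' k ord0 @[s' --> s] --> l k ord0.
  by move=> cl; apply: (cvg_comp _ _ cl (@coord_continuous R n 1 k ord0 l)).
by apply: cvgD; apply: cvgM; [exact: cc|exact: cD|exact: cc|exact: cD].
Qed.

Lemma C2_curve (x : R -> E) : is_Ck 2 [set: R] x ->
  [/\ forall t, differentiable x t, forall t, differentiable x^`()%classic t &
      continuous (x^`()^`())%classic].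
Proof.
move=> [dx cx]; have E1 : x^`()%classic = (fun t => 'D_1 x t).
  by apply/funext => t; rewrite derive1E.
have [d1x c1x] := cx 1; split=> t; first exact: dx.
  by rewrite E1; exact: d1x.
rewrite E1 (_ : _^`()%classic = (fun t => 'D_1 (fun t => 'D_1 x t) t)).
  exact: c1x.
by apply/funext => s; rewrite derive1E.
Qed.

Lemma jet_diff (x : R -> E) t : is_Ck 2 [set: R] x ->
  differentiable (jet x) t /\
  'D_1 (jet x) t = (1, (x^`()%classic t, (x^`()^`())%classic t)).
Proof.
move=> /C2_curve[dx d1x _].
have dp : differentiable (fun s => (x s, x^`()%classic s)) t.
  exact: differentiable_pair.
have did : differentiable (fun s : R => s) t by [].
have dj : differentiable (jet x) t by exact: differentiable_pair.
split=> //; rewrite (deriveE _ dj) /jet (diff_pair did dp) (diff_pair (dx t) (d1x t)).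
have e1 : 'd (fun s : R => s) t 1 = 1 by rewrite -deriveE// derive_id.
have e2 : 'd x t 1 = (x^`())%classic t by rewrite derive1E (deriveE _ (dx t)).
have e3 : 'd (x^`()%classic) t 1 = (x^`()^`())%classic t.
  by rewrite [RHS]derive1E (deriveE _ (d1x t)).
by congr (_, (_, _)); [exact: e1|exact: e2|exact: e3].
Qed.

Lemma jet_continuous (x : R -> E) t : is_Ck 2 [set: R] x ->
  {for t, continuous (jet x)}.
Proof. by move=> /(jet_diff t)[/differentiable_continuous]. Qed.

(** The total time derivative d/dt F(t, x, x') as given by the chain rule. *)
Definition along (F : U -> R) (x : R -> E) (t : R) : R :=
  'D_(1, (x^`()%classic t, (x^`()^`())%classic t)) F (jet x t).

Lemma is_derive_along (P : set U) (F : U -> R) (x : R -> E) (t : R) :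
  is_Ck 1 P F -> is_Ck 2 [set: R] x -> P (jet x t) ->
  is_derive t (1 : R) (fun s => F (jet x s)) (along F x t).
Proof.
move=> [dF _] Cx Pt; have [dj Dj] := jet_diff t Cx.
have dFj : differentiable (F \o jet x) t.
  by apply: differentiable_comp => //; exact: dF.
apply: DeriveDef; first exact: (diff_derivable dFj).
by rewrite (derive_comp _ dj (dF _ Pt)) Dj.
Qed.

Lemma along_continuous (P : set U) (F : U -> R) (x : R -> E) (t : R) :
  open P -> is_Ck 1 P F -> is_Ck 2 [set: R] x -> P (jet x t) ->
  {for t, continuous (along F x)}.
Proof.
move=> oP CF Cx Pt; have [_ d1x c2x] := C2_curve Cx.
apply: (derive_dir_continuous oP CF Pt (@jet_continuous x t Cx)).
apply: pair_continuous; first exact: cvg_cst.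
apply: pair_continuous; last exact: c2x.
exact: (differentiable_continuous (d1x t)).
Qed.

End Phase.

(** * The Euler-Lagrange equation of a C^1 Lagrangian *)

Section EulerLagrange.
Variables (R : realType) (n : nat).
Local Notation E := 'cV[R]_n.
Local Notation U := (R * (E * E))%type.
Local Notation mu := (@lebesgue_measure R).

(** The direction in which the lift of x + e *: eta moves with e. *)
Definition jet_dir (eta : R -> E) (t : R) : U := (0, (eta t, eta^`()%classic t)).

Lemma jet_variation (x eta : R -> E) (e t : R) :
  is_Ck 2 [set: R] x -> is_Ck 2 [set: R] eta ->
  jet (fun s => x s + e *: eta s) t = jet x t + e *: jet_dir eta t.
Proof.
move=> /C2_curve[dx _ _] /C2_curve[deta _ _].
congr (_, (_, _)) => /=; first by rewrite scaler0 addr0.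
have -> : (fun s => x s + e *: eta s) = x + e \*: eta by [].
have dZ : derivable (e \*: eta) t 1.
  by apply: derivableZ; exact: diff_derivable.
rewrite [LHS]derive1E (deriveD (diff_derivable (dx t)) dZ).
by rewrite (deriveZ e (diff_derivable (deta t))) -!derive1E.
Qed.

Lemma Ck_variation (x eta : R -> E) (e : R) :
  is_Ck 2 [set: R] x -> is_Ck 2 [set: R] eta ->
  is_Ck 2 [set: R] (fun s => x s + e *: eta s).
Proof.
by move=> Cx Ceta; exact: (Ck_add openT Cx (Ck_scale e openT Ceta)).
Qed.

Lemma jet_dir_continuous (eta : R -> E) t : is_Ck 2 [set: R] eta ->
  {for t, continuous (jet_dir eta)}.
Proof.
move=> /C2_curve[deta d1eta _]; apply: pair_continuous; first exact: cvg_cst.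
by apply: pair_continuous; apply: differentiable_continuous.
Qed.

Lemma continuous_snd_comp (V W : topologicalType) (f : V -> W)
    (p : R * V) :
  {for p.2, continuous f} -> {for p, continuous (fun q : R * V => f q.2)}.
Proof.
case: p => a v /= cf; apply: (@continuous_comp _ _ _ snd f) => //.
exact: cvg_snd.
Qed.

Lemma variation_continuous (z w : R -> U) (p : R * R) :
  {for p.2, continuous z} -> {for p.2, continuous w} ->
  {for p, continuous (fun q : R * R => z q.2 + q.1 *: w q.2)}.
Proof.
move=> cz cw; apply: continuousD; first exact: continuous_snd_comp.
apply: continuousZ; last exact: continuous_snd_comp.
by case: p {cz cw} => a b; exact: cvg_fst.
Qed.

(** Compactness of [t0, tf]: the condition is open in (e, t) and holds at e = 0
    for every t. *)
Lemma near_variation (P : set U) (t0 tf : R) (x eta : R -> E) : open P ->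
  is_Ck 2 [set: R] x -> is_Ck 2 [set: R] eta ->
  (forall t, t0 <= t <= tf -> P (jet x t)) ->
  \forall e \near (0 : R), forall t, t0 <= t <= tf ->
    P (jet x t + e *: jet_dir eta t).
Proof.
move=> oP Cx Ceta Px.
have /compact_near_coveringP nc := @segment_compact R t0 tf.
have := nc _ (nbhs (0 : R)) (fun e t => P (jet x t + e *: jet_dir eta t)) _.
case=> [t|r r0 rP].
  rewrite /= in_itv /= => /Px Pt.
  have cz := @variation_continuous (jet x) (jet_dir eta) (0, t)
    (jet_continuous Cx) (jet_dir_continuous Ceta).
  have nP : nbhs (jet x t + (0 : R) *: jet_dir eta t) P.
    by rewrite scale0r addr0; exact: open_nbhs_nbhs.
  have [[A B] /= [A0 Bt]] := cz _ nP.
  move=> AB; exists (B, A); first by split.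
  by move=> [s e] [Bs Ae]; exact: (AB (e, s) (conj Ae Bs)).
by exists r => // e re t tab; apply: rP; rewrite // in_itv.
Qed.

Section Stationary.
Variables (P : set U) (L : U -> R) (t0 tf : R) (J : (R -> E) -> R) (x : R -> E).
Hypotheses (oP : open P) (CL : is_Ck 1 P L).
Hypothesis CLv : forall k, is_Ck 1 P (fun z => 'D_(dirv R k) L z).
Hypotheses (t0tf : t0 < tf) (Cx : is_Ck 2 [set: R] x).
Hypothesis Px : forall t, t0 <= t <= tf -> P (jet x t).
Hypothesis JE : forall y, is_Ck 2 [set: R] y ->
  (forall t, t0 <= t <= tf -> P (jet y t)) ->
  J y = (\int[mu]_(t in `[t0, tf]) L (jet y t))%R.

Let A k := along (fun z => 'D_(dirv R k) L z) x.
Let G k t := 'D_(dirx R k) L (jet x t) - A k t.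

Let G_continuous k t : t0 <= t <= tf -> {for t, continuous (G k)}.
Proof.
move=> tab; apply: continuousB; last first.
  exact: (along_continuous oP (CLv k) Cx (Px tab)).
apply: (derive_dir_continuous oP CL (Px tab)); first exact: jet_continuous.
exact: cvg_cst.
Qed.

(** Differentiating under the integral sign gives the integral of
    (dL/dx) . eta + (dL/dv) . eta'.  The second term is
    d/dt ((dL/dv) . eta) - (d/dt dL/dv) . eta, and the total derivative integrates
    to zero because eta vanishes at both ends. *)
Lemma first_variation (eta : R -> E) : is_Ck 2 [set: R] eta ->
  eta t0 = 0 -> eta tf = 0 ->
  is_derive (0 : R) (1 : R) (fun e : R => J (fun t => x t + e *: eta t))
    (\int[mu]_(t in `[t0, tf]) (\sum_k G k t * eta t k ord0))%R.
Proof.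
move=> Ceta eta0 etaf.
have [dL cL] := CL.
have [dx d1x c2x] := C2_curve Cx; have [deta d1eta c2eta] := C2_curve Ceta.
pose F e t := L (jet x t + e *: jet_dir eta t).
pose F' e t := 'D_(jet_dir eta t) L (jet x t + e *: jet_dir eta t).
have nP := near_variation oP Cx Ceta Px.
have cz (e t : R) : {for t, continuous (fun s => jet x s + e *: jet_dir eta s)}.
  apply: continuousD; first exact: jet_continuous.
  by apply: cvgZl_tmp; exact: jet_dir_continuous.
have dF : is_derive (0 : R) (1 : R)
    (fun e => (\int[mu]_(t in `[t0, tf]) F e t)%R)
    ((\int[mu]_(t in `[t0, tf]) F' 0 t)%R).
  apply: is_derive_Rintegral.
  - apply: filterS nP => e Pe t tab.
    pose z s := jet x t + s *: jet_dir eta t.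
    have did : differentiable (fun s : R => s) e by [].
    have dz : differentiable z e.
      by apply: differentiableD => //; exact: differentiableZl.
    have dLz : differentiable L (z e) by apply: dL; exact: Pe.
    have dLz' : differentiable (L \o z) e by exact: differentiable_comp.
    apply: DeriveDef; first exact: (diff_derivable dLz').
    rewrite (derive_comp _ dz dLz) /F' -/(z e); congr ('D_ _ L (z e)).
    have dZ : differentiable (fun s : R => s *: jet_dir eta t) e.
      exact: differentiableZl.
    have dc : derivable (cst (jet x t)) e (1 : R) by [].
    rewrite /z (deriveD dc (diff_derivable dZ)) derive_cst add0r.
    rewrite (deriveE _ dZ) diffZl// -[in RHS](scale1r (jet_dir eta t)).
    by congr (_ *: _); rewrite -deriveE// derive_id.
  - apply: filterS nP => e Pe t tab.
    apply: (@continuous_comp _ _ _ (fun s => jet x s + e *: jet_dir eta s) L).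
      exact: cz.
    exact/differentiable_continuous/dL/Pe.
  - move=> t tab; apply: (derive_dir_continuous oP CL).
    + by rewrite /= scale0r addr0; exact: Px.
    + by apply: variation_continuous; [exact: jet_continuous|exact: jet_dir_continuous].
    + by apply: continuous_snd_comp; exact: jet_dir_continuous.
have EJ : \forall e \near (0 : R),
    (\int[mu]_(t in `[t0, tf]) F e t)%R = J (fun t => x t + e *: eta t).
  apply: filterS nP => e Pe; rewrite JE; first last.
  - by move=> t tab; rewrite jet_variation//; exact: Pe.
  - exact: Ck_variation.
  by apply: eq_Rintegral => t _; rewrite /F jet_variation.
have := near_eq_is_derive EJ dF; congr (is_derive _ _ _ _).
(* Y is (dL/dv) . eta and Y' its derivative. *)
pose Y t := \sum_k 'D_(dirv R k) L (jet x t) * eta t k ord0.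
pose Y' t := \sum_k ('D_(dirv R k) L (jet x t) * eta^`()%classic t k ord0
                     + A k t * eta t k ord0).
have byparts (a b c d e : R) : a * b + c * d = (d * c + e * a) + (b - e) * a.
  by ring.
have F'E t : t0 <= t <= tf ->
    F' 0 t = Y' t + \sum_k G k t * eta t k ord0.
  move=> tab; rewrite /F' scale0r addr0 phase_dirE; last exact/dL/Px.
  rewrite /= mul0r add0r -big_split /=; apply: eq_bigr => k _.
  exact: byparts.
have ceta k t : {for t, continuous (fun s => eta s k ord0)}.
  apply: (@continuous_comp _ _ _ eta (fun M : E => M k ord0)).
    exact: differentiable_continuous.
  exact: coord_continuous.
have ceta' k t : {for t, continuous (fun s => eta^`()%classic s k ord0)}.
  apply: (@continuous_comp _ _ _ (eta^`()%classic) (fun M : E => M k ord0)).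
    exact: differentiable_continuous.
  exact: coord_continuous.
have cY' t : t0 <= t <= tf -> {for t, continuous Y'}.
  move=> tab; apply: (cvg_big (@add_continuous R)) => k _.
  apply: cvgD; apply: cvgM; [|exact: ceta'| |exact: ceta].
    apply: (derive_dir_continuous oP CL (Px tab)); first exact: jet_continuous.
    exact: cvg_cst.
  exact: (along_continuous oP (CLv k) Cx (Px tab)).
have cS t : t0 <= t <= tf ->
    {for t, continuous (fun t => \sum_k G k t * eta t k ord0)}.
  move=> tab; apply: (cvg_big (@add_continuous R)) => k _.
  by apply: cvgM; [exact: G_continuous|exact: ceta].
have dY t : t0 <= t <= tf -> is_derive t (1 : R) Y (Y' t).
  move=> tab.
  have -> : Y = \sum_k (fun t => 'D_(dirv R k) L (jet x t) * eta t k ord0).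
    by apply/funext => s; rewrite fct_sumE.
  apply: is_derive_sum => k.
  have d1 := is_derive_along (CLv k) Cx (Px tab).
  have d2 : is_derive t (1 : R) (fun s => eta s k ord0)
      (eta^`()%classic t k ord0).
    have de : derivable eta t 1 by exact: diff_derivable.
    apply: DeriveDef; first exact: (derivable_mxP _ _ _).1.
    by rewrite derive1E derive_mx// mxE.
  have := is_deriveM d1 d2; rewrite /= /A => d12.
  apply: is_derive_eq d12 _.
  by rewrite /GRing.scale /= [X in _ + X]mulrC.
have intY' : (\int[mu]_(t in `[t0, tf]) Y' t)%R = 0.
  have Y0 s : eta s = 0 -> Y s = 0.
    by move=> es; rewrite /Y es; apply: big1 => k _; rewrite mxE mulr0.
  rewrite (Rintegral_derive t0tf dY cY') (Y0 _ etaf) (Y0 _ eta0).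
  exact: subr0.
have := Rintegral_continuousD cY' cS; rewrite intY' add0r => <-.
by apply: eq_Rintegral => t /set_mem; rewrite /= in_itv /= => /F'E.
Qed.

(** Variations phi *: e_k along one basis vector make the k-th component G k of
    dL/dx - d/dt dL/dv orthogonal to every C^2 function phi that vanishes at both
    ends, so the fundamental lemma applies.  Conversely G = 0 kills the first
    variation. *)
Theorem stationary_euler_lagrange :
  stationary t0 tf J x <->
  forall t, t0 <= t <= tf -> forall k,
    along (fun z => 'D_(dirv R k) L z) x t = 'D_(dirx R k) L (jet x t).
Proof.
split=> [st t tab k|EL eta Ceta eta0 etaf]; last first.
  have := first_variation Ceta eta0 etaf; congr (is_derive _ _ _ _).
  rewrite -[RHS](mul0r (fine (mu `[t0, tf]))) -Rintegral_cst//.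
  apply: eq_Rintegral => t /set_mem; rewrite /= in_itv /= => tab.
  by rewrite big1// => k _; rewrite /G /A EL// subrr mul0r.
suff G0 : forall s, t0 <= s <= tf -> G k s = 0.
  by apply/esym/eqP; rewrite -subr_eq0; apply/eqP; exact: (G0 t tab).
apply: (fundamental_lemma t0tf); first by move=> s; exact: G_continuous.
move=> phi Cphi phi0 phif.
pose eta s : E := phi s *: ebasis R k.
have Ceta : is_Ck 2 [set: R] eta by exact: (Ck_scalel _ openT Cphi).
have eta0 : eta t0 = 0 by rewrite /eta phi0 scale0r.
have etaf : eta tf = 0 by rewrite /eta phif scale0r.
have [_ D0] := st eta Ceta eta0 etaf.
have [_ D1] := first_variation Ceta eta0 etaf.
rewrite -D0 D1; apply: eq_Rintegral => s _.
rewrite (bigD1 k)//= big1 ?addr0 => [|j jk]; rewrite !mxE eqxx.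
  by rewrite eqxx mulr1.
by rewrite (negbTE jk) mulr0 mulr0.
Qed.

End Stationary.
End EulerLagrange.

(** * The force of a conservative system *)

Section PointwiseDerivatives.
Variables (R : realType) (U : normedModType R).
Implicit Types (F G : U -> R) (x v : U).

Lemma is_derive_sumf (n : nat) (F : 'I_n -> U -> R) (dF : 'I_n -> R) x v :
  (forall i, is_derive x v (F i) (dF i)) ->
  is_derive x v (fun y => \sum_i F i y) (\sum_i dF i).
Proof.
move=> dFi; rewrite (_ : (fun y => _) = \sum_i F i); first exact: is_derive_sum.
by apply/funext => y; rewrite fct_sumE.
Qed.

Lemma is_derive_mulf F G x v (dF dG : R) :
  is_derive x v F dF -> is_derive x v G dG ->
  is_derive x v (fun y => F y * G y) (F x * dG + G x * dF).
Proof. by move=> dFx dGx; exact: is_deriveM. Qed.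

Lemma is_derive_addf F G x v (dF dG : R) :
  is_derive x v F dF -> is_derive x v G dG ->
  is_derive x v (fun y => F y + G y) (dF + dG).
Proof. by move=> dFx dGx; exact: is_deriveD. Qed.

Lemma is_derive_scalef F x v (c dF : R) :
  is_derive x v F dF -> is_derive x v (fun y => c * F y) (c * dF).
Proof. by move=> dFx; exact: is_deriveZ. Qed.

Lemma is_derive_mulrf F x v (c dF : R) :
  is_derive x v F dF -> is_derive x v (fun y => F y * c) (dF * c).
Proof.
move=> dFx; rewrite (_ : (fun y => _) = (fun y => c * F y)).
  by rewrite mulrC; exact: is_derive_scalef.
by apply/funext => y; rewrite mulrC.
Qed.

Lemma is_derive_coord (n : nat) (c : U -> 'cV[R]_n) (dc : 'cV[R]_n) x v i :
  is_derive x v c dc -> is_derive x v (fun y => c y i ord0) (dc i ord0).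
Proof.
move=> [dcx <-]; apply: DeriveDef; first exact: (derivable_mxP _ _ _).1.
by rewrite derive_mx// mxE.
Qed.

End PointwiseDerivatives.

Lemma half_add_self (R : realType) (s : R) : 2^-1 * (s + s) = s.
Proof. by lra. Qed.

Section Mechanics.
Variables (R : realType) (n d N : nat) (Q : set 'cV[R]_n).
Variables (m : 'I_N -> R) (r : 'I_N -> 'cV[R]_n -> 'cV[R]_d).
Variables (V : 'cV[R]_n -> R) (f : 'cV[R]_n -> 'cV[R]_n -> 'cV[R]_n).
Local Notation E := 'cV[R]_n.
Local Notation M := (mass_matrix m r).

Definition dmass (l i j : 'I_n) (x : E) : R := partial l (fun y => M y i j) x.

Lemma mass_matrixE x i j :
  M x i j = \sum_a m a * \sum_c (partial i (fun y => r a y c ord0) x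
                                * partial j (fun y => r a y c ord0) x).
Proof.
rewrite summxE; apply: eq_bigr => a _; rewrite !mxE; congr (_ * _).
by apply: eq_bigr => c _; rewrite !mxE.
Qed.

Lemma mass_matrix_sym x i j : M x i j = M x j i.
Proof.
rewrite !mass_matrixE; apply: eq_bigr => a _; congr (_ * _).
by apply: eq_bigr => c _; rewrite mulrC.
Qed.

(** The sum of the |J_a v|^2 weighted by m_a is v^T M v. *)
Lemma kineticE x v :
  kinetic m r x v = 2^-1 * \sum_i \sum_j M x i j * (v i ord0 * v j ord0).
Proof.
rewrite /kinetic; congr (_ * _).
transitivity ((v^T *m (M x *m v)) ord0 ord0).
  rewrite /mass_matrix mulmx_suml mulmx_sumr summxE; apply: eq_bigr => a _.
  rewrite -scalemxAl -scalemxAr mxE; congr (_ * _).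
  by rewrite /dot trmx_mul -!mulmxA.
rewrite mxE; apply: eq_bigr => i _; rewrite !mxE mulr_sumr.
by apply: eq_bigr => j _; rewrite mulrCA.
Qed.

Hypothesis sys : conservative_system Q m r V f.

Lemma Ck_mass i j : is_Ck 2 Q (fun x => M x i j).
Proof.
have oQ := cs_open sys.
rewrite (_ : (fun x => _) = (fun x => \sum_a m a *
  \sum_c (partial i (fun y => r a y c ord0) x
        * partial j (fun y => r a y c ord0) x))); last first.
  by apply/funext => x; rewrite mass_matrixE.
have Cr a c (l : 'I_n) : is_Ck 2 Q (partial l (fun y => r a y c ord0)).
  have [_] := Ck_coord c ord0 oQ (cs_r_C3 sys a); exact.
apply: (Ck_sum _ _ oQ) => a; apply: (Ck_mul oQ); first exact: Ck_cst.
by apply: (Ck_sum _ _ oQ) => c; exact: (Ck_mul oQ (Cr _ _ _) (Cr _ _ _)).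
Qed.

Lemma Ck_dmass l i j : is_Ck 1 Q (dmass l i j).
Proof. by have [_] := Ck_mass i j; exact. Qed.

Lemma Ck_partialV l : is_Ck 1 Q (partial l V).
Proof. by have [_] := cs_V_C2 sys; exact. Qed.

(** The momentum of the quadratic form (1/2) v^T M v is M v, by symmetry of M. *)
Lemma grad_velocity y v : grad (mech_lagrangian m r V y) v = M y *m v.
Proof.
apply/matrixP => k o; rewrite ord1 !mxE /partial.
rewrite (_ : mech_lagrangian m r V y = fun v => 2^-1 * \sum_i \sum_j M y i j *
    (v i ord0 * v j ord0) + (- V y)); last first.
  by apply/funext => z; rewrite /mech_lagrangian kineticE.
set e := delta_mx k ord0.
have dv i : is_derive v e (fun z : E => z i ord0) (e i ord0).
  by apply: is_derive_coord; exact: is_derive_id.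
have := is_derive_addf (is_derive_scalef 2^-1 (is_derive_sumf (fun i =>
  is_derive_sumf (fun j => is_derive_scalef (M y i j)
    (is_derive_mulf (dv i) (dv j)))))) (is_derive_cst (- V y) v e).
move=> [_ ->]; rewrite addr0.
have eE i : e i ord0 = (i == k)%:R by rewrite /e mxE eqxx andbT.
under eq_bigr => i _ do under eq_bigr => j _ do rewrite !eE mulrDr.
under eq_bigr => i _ do rewrite big_split /=.
rewrite big_split /=.
have -> : \sum_i \sum_j M y i j * (v i ord0 * (j == k)%:R)
    = \sum_j M y k j * v j ord0.
  apply: eq_bigr => i _; rewrite (bigD1 k)//= eqxx mulr1 big1 ?addr0.
    by rewrite mass_matrix_sym.
  by move=> j /negbTE ->; rewrite !mulr0.
have -> : \sum_i \sum_j M y i j * (v j ord0 * (i == k)%:R)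
    = \sum_j M y k j * v j ord0.
  rewrite (bigD1 k)//= [X in _ + X]big1 ?addr0 => [|i /negbTE ->].
    by apply: eq_bigr => j _; rewrite eqxx mulr1.
  by apply: big1 => j _; rewrite !mulr0.
by rewrite half_add_self.
Qed.

Lemma grad_position x v k : Q x ->
  grad (fun y => mech_lagrangian m r V y v) x k ord0 =
  2^-1 * \sum_i \sum_j dmass k i j x * (v i ord0 * v j ord0) - partial k V x.
Proof.
move=> Qx; rewrite !mxE /partial.
rewrite (_ : (fun y => mech_lagrangian m r V y v) =
    fun y => 2^-1 * (\sum_i \sum_j M y i j * (v i ord0 * v j ord0)) + -1 * V y).
  set e := delta_mx k ord0.
  have dM i j : is_derive x e (fun y => M y i j) (dmass k i j x).
    have [dMx _] := Ck_mass i j.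
    by apply: DeriveDef => //; exact: (diff_derivable (dMx x Qx)).
  have dV : is_derive x e V (partial k V x).
    have [dVx _] := cs_V_C2 sys.
    by apply: DeriveDef => //; exact: (diff_derivable (dVx x Qx)).
  have [_ ->] := is_derive_addf (is_derive_scalef 2^-1 (is_derive_sumf (fun i =>
    is_derive_sumf (fun j => is_derive_mulrf (v i ord0 * v j ord0) (dM i j)))))
    (is_derive_scalef (-1) dV).
  by rewrite mulN1r.
by apply/funext => y; rewrite /mech_lagrangian kineticE mulN1r.
Qed.

(** A curve with position x, velocity v and acceleration a at time 0. *)
Definition quad_curve (x v a : E) (s : R) : E :=
  x + s *: v + (2^-1 * (s * s)) *: a.

Lemma is_derive_scalel (F : R -> R) (w : E) (s dF : R) :
  is_derive s (1 : R) F dF -> is_derive s (1 : R) (fun t => F t *: w) (dF *: w).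
Proof.
move=> [dFs <-]; have dF' : differentiable F s by exact/derivable1_diffP.
have dZ : differentiable (fun t => F t *: w) s by exact: differentiableZl.
apply: DeriveDef; first exact: (diff_derivable dZ).
by rewrite (deriveE _ dZ) diffZl// (deriveE _ dF').
Qed.

Lemma quad_curve_derive x v a s :
  is_derive s (1 : R) (quad_curve x v a) (v + s *: a).
Proof.
have d1 : is_derive s (1 : R) (fun t : R => t) 1 by exact: is_derive_id.
have d2 : is_derive s (1 : R) (fun t => 2^-1 * (t * t)) s.
  apply: is_derive_eq (is_derive_scalef 2^-1 (is_derive_mulf d1 d1)) _.
  by rewrite mulr1 half_add_self.
have := is_deriveD (is_deriveD (is_derive_cst x s (1 : R))
  (is_derive_scalel v d1)) (is_derive_scalel a d2).
by rewrite add0r scale1r.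
Qed.

Lemma quad_curve_derive1 x v a :
  (quad_curve x v a)^`()%classic = fun s => v + s *: a.
Proof.
by apply/funext => s; rewrite derive1E; have [_ ->] := quad_curve_derive x v a s.
Qed.

Lemma quad_curve_derive2 (v a : E) (s : R) :
  is_derive s (1 : R) (fun s : R => v + s *: a) a.
Proof.
have d1 : is_derive s (1 : R) (fun t : R => t) 1 by exact: is_derive_id.
have := is_deriveD (is_derive_cst v s (1 : R)) (is_derive_scalel a d1).
by rewrite add0r scale1r.
Qed.

Lemma Ck_quad_curve x v a : is_Ck 2 [set: R] (quad_curve x v a).
Proof.
have Cid : is_Ck 2 [set: R] (fun s : R => s).
  by apply: (@Ck_lin R R R 2 id setT) => // s; exact: cvg_id.
have Ch : is_Ck 2 [set: R] (fun s : R => 2^-1 * (s * s)).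
  exact: (Ck_mul openT (Ck_cst 2 setT (2^-1 : R)) (Ck_mul openT Cid Cid)).
exact: (Ck_add openT (Ck_add openT (Ck_cst 2 setT x) (Ck_scalel v openT Cid))
                     (Ck_scalel a openT Ch)).
Qed.

Lemma derive_sum_partial (F : E -> R) x v : differentiable F x ->
  'D_v F x = \sum_i v i ord0 * partial i F x.
Proof.
move=> dF; rewrite (deriveE _ dF) {1}(matrix_sum_delta v) linear_sum.
apply: eq_bigr => i _; rewrite big_ord1 linearZ /=.
by rewrite /partial (deriveE _ dF).
Qed.

(** The terms of the Euler-Lagrange equation that are quadratic in the velocity,
    moved to the right-hand side: the vector w with g = M^-1 w. *)
Definition inertia (x v : E) : E := \col_k
  \sum_i \sum_j (2^-1 * dmass k i j x - dmass i k j x) * (v i ord0 * v j ord0).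

(** Let a be the right-hand side.  The curve through (x, v) with acceleration a
    satisfies the Euler-Lagrange equation at time 0, because M a equals
    inertia x v - grad V x; hence it satisfies the equation of motion there,
    which says a = f x v. *)
Lemma motion_explicit x v : Q x ->
  f x v = invmx (M x) *m (inertia x v - grad V x).
Proof.
move=> Qx; set a := RHS.
pose c := quad_curve x v a.
have c0 : c 0 = x by rewrite /c /quad_curve scale0r !mul0r mulr0 scale0r !addr0.
have c'E := quad_curve_derive1 x v a.
have c'0 : c^`()%classic 0 = v by rewrite c'E scale0r addr0.
have c''0 : derive1n 2 c 0 = a.
  rewrite derive1nS derive1n1 c'E derive1E.
  by have [_ ->] := quad_curve_derive2 v a 0.
have := cs_motion sys (Ck_quad_curve x v a) (t := 0).
rewrite -/c c0 c'0 c''0 => /(_ Qx)[_ <-//].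
rewrite /euler_lagrange c0 c'0.
rewrite (_ : (fun s => _) = fun s => M (c s) *m (v + s *: a)); last first.
  by apply/funext => s; rewrite grad_velocity c'E.
have Ma : M x *m a = inertia x v - grad V x.
  by rewrite /a mulKVmx//; exact: (cs_mass_unit sys).
(* The derivative of the momentum M(c) c' at time 0. *)
have dp k : is_derive (0 : R) (1 : R)
    (fun s => (M (c s) *m (v + s *: a)) k ord0)
    (\sum_j (M x k j * a j ord0
       + v j ord0 * \sum_i v i ord0 * dmass i k j x)).
  rewrite (_ : (fun s => _) =
      fun s => \sum_j M (c s) k j * (v + s *: a) j ord0); last first.
    by apply/funext => s; rewrite mxE.
  apply: is_derive_sumf => j.
  have [dM _] := Ck_mass k j.
  have dMx : differentiable (fun y => M y k j) (c 0) by rewrite c0; exact: dM.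
  have dc : differentiable c 0.
    by apply/derivable1_diffP; have [] := quad_curve_derive x v a 0.
  have dMc : is_derive (0 : R) (1 : R) (fun s => M (c s) k j)
      (\sum_i v i ord0 * dmass i k j x).
    have dMc : differentiable ((fun y => M y k j) \o c) 0.
      exact: differentiable_comp.
    apply: DeriveDef; first exact: (diff_derivable dMc).
    rewrite (derive_comp _ dc dMx); have [_ ->] := quad_curve_derive x v a 0.
    by rewrite scale0r addr0 c0 derive_sum_partial//; exact: dM.
  have da := is_derive_coord j (quad_curve_derive2 v a 0).
  have := is_derive_mulf dMc da.
  by rewrite c0 scale0r addr0.
have dpm : derivable (fun s => M (c s) *m (v + s *: a)) 0 1.
  by apply/derivable_mxP => k o; rewrite ord1; have [] := dp k.
apply/matrixP => k o; rewrite ord1 derive1E derive_mx// mxE mxE mxE.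
have [_ ->] := dp k.
have := congr1 (fun A : E => A k ord0) Ma; rewrite !mxE => Mak.
have := grad_position v k Qx; rewrite !mxE => ->.
rewrite big_split /= Mak.
have -> : \sum_i \sum_j (2^-1 * dmass k i j x - dmass i k j x)
      * (v i ord0 * v j ord0)
    = 2^-1 * (\sum_i \sum_j dmass k i j x * (v i ord0 * v j ord0))
      - \sum_i v i ord0 * \sum_j v j ord0 * dmass j k i x.
  under eq_bigr do under eq_bigr do rewrite mulrBl -mulrA.
  under eq_bigr do rewrite sumrB -mulr_sumr.
  rewrite sumrB -mulr_sumr; congr (_ - _); rewrite exchange_big /=.
  apply: eq_bigr => i _; rewrite mulr_sumr; apply: eq_bigr => j _.
  by rewrite [RHS]mulrA [RHS]mulrC [in RHS](mulrC (v i ord0)).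
have cancel (X Y Z : R) : X - Y - Z + Y - (X - Z) = 0 by ring.
exact: cancel.
Qed.

(** Up to sign and symmetrization in i and j, the Christoffel symbols of the
    metric M. *)
Definition gamma (k i j : 'I_n) (x : E) : R :=
  \sum_l invmx (M x) k l * (2^-1 * dmass l i j x - dmass i l j x).

Lemma Ck_inv_mass k l : is_Ck 1 Q (fun x => invmx (M x) k l).
Proof.
apply: Ck_invmx; [exact: cs_open sys|exact: cs_mass_unit sys|].
by move=> i j; exact: (Ck_pred (Ck_mass i j)).
Qed.

Lemma Ck_gamma k i j : is_Ck 1 Q (gamma k i j).
Proof.
have oQ := cs_open sys.
apply: (Ck_sum _ _ oQ) => l; apply: (Ck_mul oQ (Ck_inv_mass k l)).
apply: (Ck_add oQ); last exact: (Ck_opp oQ (Ck_dmass i l j)).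
exact: (Ck_mul oQ (Ck_cst 1 Q (2^-1 : R)) (Ck_dmass l i j)).
Qed.

Lemma Ck_h_part k : is_Ck 1 Q (fun x => h_part m r V x k ord0).
Proof.
have oQ := cs_open sys.
rewrite (_ : (fun x => _) =
    fun x => - \sum_l invmx (M x) k l * partial l V x); last first.
  apply/funext => x; rewrite !mxE; congr (- _).
  by apply: eq_bigr => l _; rewrite !mxE.
apply: (Ck_opp oQ); apply: (Ck_sum _ _ oQ) => l.
exact: (Ck_mul oQ (Ck_inv_mass k l) (Ck_partialV l)).
Qed.

Lemma g_partE x v k : Q x -> g_part m r V f x v k ord0 =
  \sum_i \sum_j gamma k i j x * (v i ord0 * v j ord0).
Proof.
move=> Qx; rewrite /g_part /h_part opprK (motion_explicit v Qx) -mulmxDr subrK.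
rewrite mxE.
under eq_bigr do rewrite mxE mulr_sumr.
rewrite exchange_big /=; apply: eq_bigr => i _.
under eq_bigr do rewrite mulr_sumr.
rewrite exchange_big /=; apply: eq_bigr => j _.
rewrite /gamma mulr_suml; apply: eq_bigr => l _; exact: mulrA.
Qed.

End Mechanics.

(** * The force as a function on phase space *)

(** A directional derivative sees only the restriction of the function to a line. *)
Lemma derive_line (R : realType) (V1 V2 W : normedModType R) (F : V1 -> W)
    (G : V2 -> W) (x v : V1) (y w : V2) :
  (forall h : R, F (h *: v + x) = G (h *: w + y)) -> 'D_v F x = 'D_w G y.
Proof.
move=> FG; rewrite /derive; have FG0 := FG 0; rewrite !scale0r !add0r in FG0.
have -> // : (fun h : R => h^-1 *: ((F \o shift x) (h *: v) - F x)) =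
             (fun h : R => h^-1 *: ((G \o shift y) (h *: w) - G y)).
by apply/funext => h; rewrite /= FG FG0.
Qed.

Section PhaseFunctions.
Variables (R : realType) (n : nat).
Local Notation E := 'cV[R]_n.
Local Notation U := (R * (E * E))%type.

Lemma is_derive_lin (V W : normedModType R) (L : V -> W) (x v : V) :
  linear L -> continuous L -> is_derive x v L (L v).
Proof.
move=> lL cL.
have [//|dL DL] := @diff_comp_lin R V W W L idfun x v lL cL.
by apply: DeriveDef; [exact: (diff_derivable dL)|rewrite DL derive_id].
Qed.

Lemma time_linear : linear (fun z : U => z.1). Proof. by []. Qed.
Lemma pos_linear : linear (fun z : U => z.2.1). Proof. by []. Qed.
Lemma vel_linear : linear (fun z : U => z.2.2). Proof. by []. Qed.

Lemma time_continuous : continuous (fun z : U => z.1).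
Proof. by move=> [t y]; exact: cvg_fst. Qed.

Lemma snd_continuous : continuous (fun z : U => z.2).
Proof. by move=> [t y]; exact: cvg_snd. Qed.

Lemma pos_continuous : continuous (fun z : U => z.2.1).
Proof.
move=> z; apply: (@continuous_comp _ _ _ (fun z : U => z.2) (fun y => y.1)).
  exact: snd_continuous.
by case: z.2 => x v; exact: cvg_fst.
Qed.

Lemma vel_continuous : continuous (fun z : U => z.2.2).
Proof.
move=> z; apply: (@continuous_comp _ _ _ (fun z : U => z.2) (fun y => y.2)).
  exact: snd_continuous.
by case: z.2 => x v; exact: cvg_snd.
Qed.

Lemma is_derive_pos (z w : U) k :
  is_derive z w (fun z : U => z.2.1 k ord0) (w.2.1 k ord0).
Proof.
by apply: is_derive_coord; exact: (is_derive_lin _ _ pos_linear pos_continuous).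
Qed.

Lemma is_derive_vel (z w : U) k :
  is_derive z w (fun z : U => z.2.2 k ord0) (w.2.2 k ord0).
Proof.
by apply: is_derive_coord; exact: (is_derive_lin _ _ vel_linear vel_continuous).
Qed.

Lemma is_derive_time (a : R -> R) (z w : U) : w.1 = 0 ->
  is_derive z w (fun z : U => a z.1) 0.
Proof.
move=> w0.
have quot : (fun h : R => h^-1 *: (((fun z : U => a z.1) \o shift z) (h *: w)
    - a z.1)) = cst 0.
  apply/funext => h.
  by rewrite /= w0 scaler0 add0r subrr scaler0.
have c0 : (fun h : R => h^-1 *: (((fun z : U => a z.1) \o shift z) (h *: w)
    - a z.1)) @ (0 : R)^' --> (0 : R).
  by rewrite quot; exact: cvg_cst.
by apply: DeriveDef; [apply/cvg_ex; exists 0|exact: cvg_lim c0].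
Qed.

Lemma Ck_time k (O : set R) (a : R -> R) : open O -> is_Ck k O a ->
  is_Ck k [set z : U | O z.1] (fun z => a z.1).
Proof.
move=> oO Ca; exact: (Ck_comp_lin time_linear time_continuous oO Ca).
Qed.

Lemma Ck_pos k (O : set E) (a : E -> R) : open O -> is_Ck k O a ->
  is_Ck k [set z : U | O z.2.1] (fun z => a z.2.1).
Proof.
move=> oO Ca; exact: (Ck_comp_lin pos_linear pos_continuous oO Ca).
Qed.

Lemma Ck_pos_coord k (P : set U) l : open P -> is_Ck k P (fun z => z.2.1 l ord0).
Proof.
move=> oP; apply: (Ck_coord l ord0 oP).
exact: (Ck_lin k P pos_linear pos_continuous).
Qed.

Lemma Ck_vel_coord k (P : set U) l : open P -> is_Ck k P (fun z => z.2.2 l ord0).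
Proof.
move=> oP; apply: (Ck_coord l ord0 oP).
exact: (Ck_lin k P vel_linear vel_continuous).
Qed.

Lemma derive_dirx (F : U -> R) (z : U) l :
  'D_(dirx R l) F z = partial l (fun y => F (z.1, (y, z.2.2))) z.2.1.
Proof.
apply: derive_line => h; case: z => t [x v].
by congr (F (_, (_, _))); rewrite /= scaler0 add0r.
Qed.

Lemma derive_dirv (F : U -> R) (z : U) l :
  'D_(dirv R l) F z = partial l (fun y => F (z.1, (z.2.1, y))) z.2.2.
Proof.
apply: derive_line => h; case: z => t [x v].
by congr (F (_, (_, _))); rewrite /= scaler0 add0r.
Qed.

Lemma Ck_curve_coord (c : R -> E) k : is_Ck 2 [set: R] c ->
  is_Ck 1 [set: R] (fun t => c t k ord0) /\
  is_Ck 1 [set: R] (fun t => c^`()%classic t k ord0).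
Proof.
move=> Cc; split; first exact: (Ck_coord k ord0 openT (Ck_pred Cc)).
apply: (Ck_coord k ord0 openT).
have -> : c^`()%classic = (fun t => 'D_1 c t).
  by apply/funext => t; rewrite derive1E.
by have [_] := Cc; exact.
Qed.

Lemma is_derive_curve_coord (c : R -> E) k t : is_Ck 2 [set: R] c ->
  is_derive t (1 : R) (fun t => c t k ord0) (c^`()%classic t k ord0) /\
  is_derive t (1 : R) (fun t => c^`()%classic t k ord0)
    ((c^`()^`())%classic t k ord0).
Proof.
move=> /C2_curve[dc d1c _]; split; apply: is_derive_coord.
  by apply: DeriveDef; [exact: (diff_derivable (dc t))|rewrite derive1E].
by apply: DeriveDef; [exact: (diff_derivable (d1c t))|rewrite [RHS]derive1E].
Qed.

(** One order of differentiability is lost to the velocity component of the lift: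
    a C^2 curve has a C^1 lift. *)
Lemma Ck_along (P : set U) (F : U -> R) (x : R -> E) :
  open P -> is_Ck 1 P F -> is_Ck 2 [set: R] x ->
  open [set t | P (jet x t)] /\
  is_Ck 1 [set t | P (jet x t)] (fun t => F (jet x t)).
Proof.
move=> oP CF Cx.
have oO : open [set t | P (jet x t)].
  by apply: open_comp => // t _; exact: jet_continuous.
split=> //.
have dj t : P (jet x t) -> is_derive t (1 : R) (fun s => F (jet x s)) (along F x t).
  by move=> Pt; exact: (is_derive_along CF Cx Pt).
have dFj t : P (jet x t) -> differentiable (fun s => F (jet x s)) t.
  by move=> /dj[+ _]; move/derivable1_diffP.
split=> [|v]; first exact: dFj.
have Ca : is_Ck 0 [set t | P (jet x t)] (fun t => along F x t * v).
  move=> t Pt; apply: continuousM; last exact: cvg_cst.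
  exact: (along_continuous oP CF Cx Pt).
apply: (Ck_congr oO _ Ca) => t Pt.
rewrite -[in RHS](mulr1 v) [RHS](derive_dirZ _ _ (dFj t Pt)).
by have [_ ->] := dj t Pt; rewrite mulrC.
Qed.

End PhaseFunctions.

Section Force.
Variables (R : realType) (n d N : nat) (Q : set 'cV[R]_n).
Variables (m : 'I_N -> R) (r : 'I_N -> 'cV[R]_n -> 'cV[R]_d).
Variables (V : 'cV[R]_n -> R) (f : 'cV[R]_n -> 'cV[R]_n -> 'cV[R]_n).
Hypothesis sys : conservative_system Q m r V f.
Local Notation E := 'cV[R]_n.
Local Notation U := (R * (E * E))%type.
Local Notation Gam := (gamma m r).

Definition force (k : 'I_n) (z : U) : R := f z.2.1 z.2.2 k ord0.
Definition over_dom : set U := [set z | Q z.2.1].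

Lemma open_over_dom : open over_dom.
Proof.
by apply: open_comp (cs_open sys) => z _; exact: pos_continuous.
Qed.

Lemma forceE x v k : Q x -> f x v k ord0 =
  \sum_i \sum_j Gam k i j x * (v i ord0 * v j ord0) + h_part m r V x k ord0.
Proof.
move=> Qx; have {1}-> : f x v = g_part m r V f x v + h_part m r V x.
  by rewrite /g_part subrK.
by rewrite mxE (g_partE sys).
Qed.

Lemma jac_velE x v k l : Q x -> jac_vel f x v k l =
  \sum_i \sum_j Gam k i j x * (v i ord0 * (j == l)%:R + v j ord0 * (i == l)%:R).
Proof.
move=> Qx; rewrite /jac_vel mxE /partial.
rewrite (_ : (fun y => f x y k ord0) = fun y : E =>
  \sum_i \sum_j Gam k i j x * (y i ord0 * y j ord0) + h_part m r V x k ord0).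
  have dv i : is_derive v (delta_mx l ord0 : E) (fun z : E => z i ord0)
      ((i == l)%:R).
    have -> : (i == l)%:R = (delta_mx l ord0 : E) i ord0.
      by rewrite mxE eqxx andbT.
    by apply: is_derive_coord; exact: is_derive_id.
  have := is_derive_addf (is_derive_sumf (fun i => is_derive_sumf (fun j =>
    is_derive_scalef (Gam k i j x) (is_derive_mulf (dv i) (dv j)))))
    (is_derive_cst (h_part m r V x k ord0) v (delta_mx l ord0)).
  by move=> [_ ->]; rewrite addr0.
by apply/funext => y; rewrite forceE.
Qed.

(** Euler's theorem for the form g, homogeneous of degree 2 in the velocity. *)
Lemma jac_vel_euler x v : Q x -> jac_vel f x v *m v = g_part m r V f x v *+ 2.
Proof.
move=> Qx; apply/matrixP => k o; rewrite ord1 mxE mulr2n mxE !(g_partE sys) //.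
under eq_bigr => l _.
  rewrite jac_velE// mulr_suml.
  under eq_bigr do rewrite mulr_suml.
  over.
rewrite exchange_big /= -big_split; apply: eq_bigr => i _.
rewrite exchange_big /= -big_split; apply: eq_bigr => j _.
have delta (a : 'I_n) : \sum_l (a == l)%:R * v l ord0 = v a ord0.
  rewrite (bigD1 a)//= eqxx mul1r big1 ?addr0// => l.
  by rewrite eq_sym => /negbTE ->; rewrite mul0r.
under eq_bigr do rewrite -mulrA mulrDl -!mulrA.
rewrite -mulr_sumr big_split /= -!mulr_sumr !delta -mulrDr.
by congr (_ * (_ + _)); exact: mulrC.
Qed.

Lemma derive_force_vel k l z : 'D_(dirv R l) (force k) z =
  jac_vel f z.2.1 z.2.2 k l.
Proof. by rewrite derive_dirv /jac_vel mxE. Qed.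

Lemma derive_force_pos k l z : 'D_(dirx R l) (force k) z =
  jac_pos f z.2.1 z.2.2 k l.
Proof. by rewrite derive_dirx /jac_pos mxE. Qed.

Lemma Ck_force k : is_Ck 1 over_dom (force k).
Proof.
have oQ := cs_open sys; have oP := open_over_dom.
have CF : is_Ck 1 over_dom (fun z : U => \sum_i \sum_j Gam k i j z.2.1 *
    (z.2.2 i ord0 * z.2.2 j ord0) + h_part m r V z.2.1 k ord0).
  apply: (Ck_add oP); last exact: (Ck_pos oQ (Ck_h_part sys k)).
  apply: (Ck_sum _ _ oP) => i; apply: (Ck_sum _ _ oP) => j.
  apply: (Ck_mul oP (Ck_pos oQ (Ck_gamma sys k i j))).
  exact: (Ck_mul oP (Ck_vel_coord 1 i oP) (Ck_vel_coord 1 j oP)).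
by apply: (Ck_congr oP _ CF) => z Qz; rewrite /force forceE.
Qed.

Lemma Ck_force_vel k l : is_Ck 1 over_dom (fun z => 'D_(dirv R l) (force k) z).
Proof.
have oQ := cs_open sys; have oP := open_over_dom.
have CF : is_Ck 1 over_dom (fun z : U => \sum_i \sum_j Gam k i j z.2.1 *
    (z.2.2 i ord0 * (j == l)%:R + z.2.2 j ord0 * (i == l)%:R)).
  apply: (Ck_sum _ _ oP) => i; apply: (Ck_sum _ _ oP) => j.
  apply: (Ck_mul oP (Ck_pos oQ (Ck_gamma sys k i j))).
  apply: (Ck_add oP).
    exact: (Ck_mul oP (Ck_vel_coord 1 i oP) (Ck_cst 1 _ ((j == l)%:R : R))).
  exact: (Ck_mul oP (Ck_vel_coord 1 j oP) (Ck_cst 1 _ ((i == l)%:R : R))).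
by apply: (Ck_congr oP _ CF) => z Qz; rewrite derive_force_vel jac_velE.
Qed.

(** With (df/dv) v = 2 g the velocity terms combine to 2 g - g + h = f. *)
Lemma control_lagrangianE x u v ud : Q x ->
  control_lagrangian f (g_part m r V f) (h_part m r V) x u v ud =
  \sum_k ud k ord0 * v k ord0 + \sum_k u k ord0 * f x v k ord0
  + 2^-1 * \sum_k u k ord0 * u k ord0.
Proof.
move=> Qx; rewrite /control_lagrangian jac_vel_euler//.
have dotE (a b : E) : dot a b = \sum_k a k ord0 * b k ord0.
  by rewrite /dot mxE; apply: eq_bigr => k _; rewrite mxE.
rewrite !dotE; congr (_ + _).
rewrite -!addrA; congr (_ + _); rewrite addrA -sumrB -big_split /=.
apply: eq_bigr => k _; rewrite -mulrBr -mulrDr; congr (_ * _).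
have -> : f x v = g_part m r V f x v + h_part m r V x.
  by rewrite /g_part subrK.
by rewrite mulr2n mxE addrK [RHS]mxE.
Qed.

End Force.

(** * The two stationarity conditions *)

Section ControlLagrangian.
Variables (R : realType) (n d N : nat) (Q : set 'cV[R]_n).
Variables (m : 'I_N -> R) (r : 'I_N -> 'cV[R]_n -> 'cV[R]_d).
Variables (V : 'cV[R]_n -> R) (f : 'cV[R]_n -> 'cV[R]_n -> 'cV[R]_n).
Hypothesis sys : conservative_system Q m r V f.
Variables (t0 tf : R) (q u : R -> 'cV[R]_n).
Hypotheses (t0tf : t0 < tf).
Hypotheses (Cq : is_Ck 2 [set: R] q) (Cu : is_Ck 2 [set: R] u).
Hypothesis qQ : forall t, t0 <= t <= tf -> Q (q t).
Local Notation E := 'cV[R]_n.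
Local Notation U := (R * (E * E))%type.
Local Notation J := (action (control_lagrangian f (g_part m r V f) (h_part m r V)) t0 tf).
Local Notation D := (over_dom Q).

Lemma sum_delta (F : 'I_n -> R) l : \sum_k F k * (k == l)%:R = F l.
Proof.
rewrite (bigD1 l)//= eqxx mulr1 big1 ?addr0// => k /negbTE ->.
by rewrite mulr0.
Qed.

Lemma ebaseE (k l : 'I_n) : ebasis R l k ord0 = (k == l)%:R.
Proof. by rewrite mxE eqxx andbT. Qed.

(** The control Lagrangian as a function of time, position q and velocity q',
    with the control u a given function of time. *)
Definition pos_lagrangian (z : U) : R :=
  \sum_k u^`()%classic z.1 k ord0 * z.2.2 k ord0
  + \sum_k u z.1 k ord0 * force f k z
  + 2^-1 * \sum_k u z.1 k ord0 * u z.1 k ord0.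

Lemma Ck_time_coord k : is_Ck 1 D (fun z : U => u z.1 k ord0) /\
  is_Ck 1 D (fun z : U => u^`()%classic z.1 k ord0).
Proof.
have [C0 C1] := Ck_curve_coord k Cu.
by split; [apply: Ck_subset (Ck_time n openT C0)|apply: Ck_subset (Ck_time n openT C1)].
Qed.

Lemma Ck_pos_lagrangian : is_Ck 1 D pos_lagrangian.
Proof.
have oD := open_over_dom sys.
apply: (Ck_add oD (Ck_add oD _ _)).
- apply: (Ck_sum _ _ oD) => k; have [_ C1] := Ck_time_coord k.
  exact: (Ck_mul oD C1 (Ck_vel_coord 1 k oD)).
- apply: (Ck_sum _ _ oD) => k; have [C0 _] := Ck_time_coord k.
  exact: (Ck_mul oD C0 (Ck_force sys k)).
- apply: (Ck_mul oD (Ck_cst 1 D (2^-1 : R))); apply: (Ck_sum _ _ oD) => k.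
  by have [C0 _] := Ck_time_coord k; exact: (Ck_mul oD C0 C0).
Qed.

Lemma derive_pos_lagrangian (z w : U) : D z -> w.1 = 0 ->
  'D_w pos_lagrangian z = \sum_k u^`()%classic z.1 k ord0 * w.2.2 k ord0
    + \sum_k u z.1 k ord0 * 'D_w (force f k) z.
Proof.
move=> Dz w0.
have dt (c : R -> E) k := is_derive_time (fun t => c t k ord0) z w0.
have df k : is_derive z w (force f k) ('D_w (force f k) z).
  have [dF _] := Ck_force sys k.
  by apply: DeriveDef => //; exact: (diff_derivable (dF z Dz)).
have [_ ->] := is_derive_addf (is_derive_addf
  (is_derive_sumf (fun k => is_derive_mulf (dt u^`()%classic k) (is_derive_vel z w k)))
  (is_derive_sumf (fun k => is_derive_mulf (dt u k) (df k))))
  (is_derive_scalef 2^-1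
    (is_derive_sumf (fun k => is_derive_mulf (dt u k) (dt u k)))).
rewrite [X in _ + 2^-1 * X]big1 ?mulr0 ?addr0 => [|k _]; last by rewrite mulr0 addr0.
by congr (_ + _); apply: eq_bigr => k _; rewrite mulr0 addr0.
Qed.

(** The momentum dL/dq' = u' + (df/dv)^T u. *)
Definition pos_momentum l (z : U) : R := u^`()%classic z.1 l ord0
  + \sum_k u z.1 k ord0 * 'D_(dirv R l) (force f k) z.

Lemma pos_momentumE l z : D z ->
  'D_(dirv R l) pos_lagrangian z = pos_momentum l z.
Proof.
move=> Dz; rewrite derive_pos_lagrangian//; congr (_ + _).
by under eq_bigr do rewrite ebaseE; exact: sum_delta.
Qed.

Lemma Ck_pos_momentum l : is_Ck 1 D (pos_momentum l).
Proof.
have oD := open_over_dom sys.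
have [_ C1] := Ck_time_coord l.
apply: (Ck_add oD C1); apply: (Ck_sum _ _ oD) => k.
have [C0 _] := Ck_time_coord k.
exact: (Ck_mul oD C0 (Ck_force_vel sys k l)).
Qed.

Let fqd := fun t => jac_vel f (q t) (derive1 q t).
Let fq := fun t => jac_pos f (q t) (derive1 q t).

Lemma is_derive_fqd t k l : t0 <= t <= tf ->
  is_derive t (1 : R) (fun s => fqd s k l) (derive1 fqd t k l).
Proof.
move=> tab.
have dfqd k' l' : is_derive t (1 : R) (fun s => fqd s k' l')
    (along (fun z => 'D_(dirv R l') (force f k') z) q t).
  have dj := is_derive_along (Ck_force_vel sys k' l') Cq (qQ tab).
  rewrite (_ : (fun s => fqd s k' l') =
    (fun s => 'D_(dirv R l') (force f k') (jet q s))) //.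
  by apply/funext => s; rewrite derive_force_vel.
have df : derivable fqd t 1.
  by apply/derivable_mxP => i j; have [] := dfqd i j.
have [dkl Dkl] := dfqd k l; apply: DeriveDef => //.
by rewrite derive1E derive_mx// mxE.
Qed.

Lemma pos_stationary : stationary t0 tf (fun x => J x u) q <->
  forall t, t0 <= t <= tf ->
    derive1n 2 u t =
      - ((fqd t)^T *m derive1 u t) - (derive1 fqd t - fq t)^T *m u t.
Proof.
have oD := open_over_dom sys.
have CLv l : is_Ck 1 D (fun z => 'D_(dirv R l) pos_lagrangian z).
  apply: (Ck_congr oD _ (Ck_pos_momentum l)) => z Dz.
  by rewrite pos_momentumE.
have JE y : is_Ck 2 [set: R] y -> (forall t, t0 <= t <= tf -> D (jet y t)) ->
    J y u = (\int[@lebesgue_measure R]_(t in `[t0, tf]) pos_lagrangian (jet y t))%R.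
  move=> _ yD; apply: eq_Rintegral => t /set_mem; rewrite /= in_itv /= => /yD Dt.
  by rewrite (control_lagrangianE sys).
apply: (iff_trans (stationary_euler_lagrange oD Ck_pos_lagrangian CLv t0tf Cq qQ JE)).
have alongE t l : t0 <= t <= tf ->
    along (fun z => 'D_(dirv R l) pos_lagrangian z) q t =
    derive1n 2 u t l ord0 + \sum_k (u t k ord0 * derive1 fqd t k l
      + fqd t k l * derive1 u t k ord0).
  move=> tab; have Dt : D (jet q t) := qQ tab.
  transitivity (along (pos_momentum l) q t).
    apply: near_eq_derive.
    by apply: filterS (open_nbhs_nbhs (conj oD Dt)) => z /pos_momentumE.
  have [_ <-] := is_derive_along (Ck_pos_momentum l) Cq Dt.
  have d1 k := is_derive_curve_coord k t Cu.
  have [_ <-] := is_derive_addf (proj2 (d1 l)) (is_derive_sumf (fun k =>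
    is_derive_mulf (proj1 (d1 k)) (is_derive_fqd k l tab))).
  congr ('D_1 _ t); apply/funext => s; rewrite /pos_momentum.
  by under eq_bigr do rewrite derive_force_vel.
have posE t l : t0 <= t <= tf ->
    'D_(dirx R l) pos_lagrangian (jet q t) = \sum_k u t k ord0 * fq t k l.
  move=> tab; rewrite derive_pos_lagrangian//; last exact: qQ.
  rewrite big1 ?add0r => [|k _]; last by rewrite mxE mulr0.
  by apply: eq_bigr => k _; rewrite derive_force_pos.
have rowE t l : (- ((fqd t)^T *m derive1 u t)
     - (derive1 fqd t - fq t)^T *m u t) l ord0 =
   \sum_k u t k ord0 * fq t k l - \sum_k (u t k ord0 * derive1 fqd t k l
      + fqd t k l * derive1 u t k ord0).
  rewrite !mxE -!sumrN -!big_split /=; apply: eq_bigr => k _; rewrite !mxE.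
  have rowring (a b c e g : R) : - (a * b) + - ((c - e) * g)
    = g * e + - (g * c + a * b) by ring.
  exact: rowring.
split=> EL t tab.
  apply/matrixP => l o; rewrite ord1 rowE -(posE _ _ tab) -(EL t tab l).
  by rewrite (alongE _ _ tab) addrK.
move=> l; rewrite (alongE _ _ tab) (posE _ _ tab) (EL t tab) rowE.
by rewrite subrK.
Qed.

(** The control Lagrangian as a function of time, position u and velocity u',
    with the curve q, hence f(q, q'), given functions of time. *)
Definition ctrl_lagrangian (z : U) : R :=
  \sum_k z.2.2 k ord0 * q^`()%classic z.1 k ord0
  + \sum_k z.2.1 k ord0 * force f k (jet q z.1)
  + 2^-1 * \sum_k z.2.1 k ord0 * z.2.1 k ord0.

(** A condition on the time alone: the values of u are unconstrained, and
    f(q, q') is C^1 at the times where q lies in Q. *)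
Definition over_time : set U := [set z | D (jet q z.1)].

Lemma ctrl_stationary : stationary t0 tf (fun y => J q y) u <->
  forall t, t0 <= t <= tf -> derive1n 2 q t = f (q t) (derive1 q t) + u t.
Proof.
have oD := open_over_dom sys.
have oO : open [set t | D (jet q t)].
  by apply: open_comp => // t _; exact: jet_continuous.
have oP : open over_time.
  apply: (open_comp (f := fun z : U => z.1)) oO => z _.
  exact: time_continuous.
have Cvel k := Ck_vel_coord 1 k oP; have Cpos k := Ck_pos_coord 1 k oP.
have Cqd k : is_Ck 1 over_time (fun z : U => q^`()%classic z.1 k ord0).
  by have [_ C1] := Ck_curve_coord k Cq; apply: Ck_subset (Ck_time n openT C1).
have Cf k : is_Ck 1 over_time (fun z : U => force f k (jet q z.1)).
  by have [_ C1] := Ck_along oD (Ck_force sys k) Cq; exact: (Ck_time n oO C1).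
have CL : is_Ck 1 over_time ctrl_lagrangian.
  apply: (Ck_add oP (Ck_add oP _ _)).
  - by apply: (Ck_sum _ _ oP) => k; exact: (Ck_mul oP (Cvel k) (Cqd k)).
  - by apply: (Ck_sum _ _ oP) => k; exact: (Ck_mul oP (Cpos k) (Cf k)).
  - apply: (Ck_mul oP (Ck_cst 1 _ (2^-1 : R))); apply: (Ck_sum _ _ oP) => k.
    exact: (Ck_mul oP (Cpos k) (Cpos k)).
have DL (z w : U) : w.1 = 0 ->
    'D_w ctrl_lagrangian z = \sum_k q^`()%classic z.1 k ord0 * w.2.2 k ord0
      + \sum_k (force f k (jet q z.1) + z.2.1 k ord0) * w.2.1 k ord0.
  move=> w0; have dt (a : R -> R) := is_derive_time a z w0.
  have [_ ->] := is_derive_addf (is_derive_addf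
    (is_derive_sumf (fun k => is_derive_mulf (is_derive_vel z w k)
      (dt (fun t => q^`()%classic t k ord0))))
    (is_derive_sumf (fun k => is_derive_mulf (is_derive_pos z w k)
      (dt (fun t => force f k (jet q t))))))
    (is_derive_scalef 2^-1 (is_derive_sumf (fun k =>
      is_derive_mulf (is_derive_pos z w k) (is_derive_pos z w k)))).
  rewrite -addrA; congr (_ + _).
    by apply: eq_bigr => k _; rewrite mulr0 add0r.
  rewrite mulr_sumr -big_split; apply: eq_bigr => k _ /=.
  by rewrite mulr0 add0r half_add_self -mulrDl.
have velE l z : 'D_(dirv R l) ctrl_lagrangian z = q^`()%classic z.1 l ord0.
  rewrite DL// [X in _ + X]big1 ?addr0 => [|k _]; last by rewrite mxE mulr0.
  by under eq_bigr do rewrite ebaseE; exact: sum_delta.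
have posE l z : 'D_(dirx R l) ctrl_lagrangian z =
    force f l (jet q z.1) + z.2.1 l ord0.
  rewrite DL// big1 ?add0r => [|k _]; last by rewrite mxE mulr0.
  by under eq_bigr do rewrite ebaseE; exact: sum_delta.
have CLv l : is_Ck 1 over_time (fun z => 'D_(dirv R l) ctrl_lagrangian z).
  by apply: (Ck_congr oP _ (Cqd l)) => z _; rewrite velE.
have JE y : is_Ck 2 [set: R] y -> (forall t, t0 <= t <= tf -> over_time (jet y t)) ->
    J q y = (\int[@lebesgue_measure R]_(t in `[t0, tf]) ctrl_lagrangian (jet y t))%R.
  move=> _ yD; apply: eq_Rintegral => t /set_mem; rewrite /= in_itv /= => /yD Dt.
  by rewrite (control_lagrangianE sys).
apply: (iff_trans (stationary_euler_lagrange oP CL CLv t0tf Cu qQ JE)).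
have alongE t l : t0 <= t <= tf ->
    along (fun z => 'D_(dirv R l) ctrl_lagrangian z) u t = derive1n 2 q t l ord0.
  move=> tab; have [_ <-] := is_derive_along (CLv l) Cu (qQ tab).
  have [_ [_ <-]] := is_derive_curve_coord l t Cq.
  by congr ('D_1 _ t); apply/funext => s; rewrite velE.
split=> EL t tab.
  apply/matrixP => l o; rewrite ord1 -(alongE _ _ tab) (EL t tab l) posE.
  by rewrite [RHS]mxE.
by move=> l; rewrite (alongE _ _ tab) (EL t tab) posE mxE.
Qed.

End ControlLagrangian.

Theorem mainTheorem2 (R : realType) (n d N : nat) (Q : set 'cV[R]_n)
    (m : 'I_N -> R) (r : 'I_N -> 'cV[R]_n -> 'cV[R]_d) (V : 'cV[R]_n -> R)
    (f : 'cV[R]_n -> 'cV[R]_n -> 'cV[R]_n)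
    (hsys : conservative_system Q m r V f)
    (t0 tf : R) (ht : t0 < tf)
    (q u : R -> 'cV[R]_n)
    (hq : is_Ck 2 [set: R] q) (hu : is_Ck 2 [set: R] u)
    (hqQ : forall t, t0 <= t <= tf -> Q (q t)) :
  let g := g_part m r V f in
  let h := h_part m r V in
  let J := action (control_lagrangian f g h) t0 tf in
  let fqd := fun t => jac_vel f (q t) (derive1 q t) in
  let fq := fun t => jac_pos f (q t) (derive1 q t) in
  (stationary t0 tf (fun x => J x u) q <->
     forall t, t0 <= t <= tf ->
       derive1n 2 u t =
         - ((fqd t)^T *m derive1 u t) - (derive1 fqd t - fq t)^T *m u t)
  /\
  (stationary t0 tf (fun y => J q y) u <->
     forall t, t0 <= t <= tf ->
       derive1n 2 q t = f (q t) (derive1 q t) + u t).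
Proof.
by split; [exact: (pos_stationary hsys ht hq hu hqQ)
          |exact: (ctrl_stationary hsys ht hq hu hqQ)].
Qed.
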